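(* Let $\mathcal{A}$ be a generalized Rabin automaton with $n$ states and $k$ generalized Rabin pairs, each with at most $\ell$ $\mathrm{Inf}$-atoms. Then there exists a generalized Büchi automaton with $k$ colours and $O(\ell^{nk}\cdot\mathrm{tight}(n+1)^k)$ states accepting $\Sigma^\omega\setminus\mathcal{L}(\mathcal{A})$; using the known estimate $\mathrm{tight}(n)\approx(0.76n)^n$, this is $O(n^k(0.76\ell n)^{nk})$ states.
   Context: A (transition-based) Emerson–Lei automaton over finite $\Sigma$ is $(Q,\delta,I,\Gamma,p,\mathit{Acc})$ with finite states $Q$, $\delta\subseteq Q\times\Sigma\times Q$, $I\subseteq Q$, colours $\Gamma$, colouring $p:\delta\to2^\Gamma$ and $\mathit{Acc}$ a $\wedge/\vee$-combination of atoms $\mathrm{Inf}(c),\mathrm{Fin}(c)$; a run is accepting iff the set $M$ of colours on transitions occurring infinitely often satisfies $\mathit{Acc}$ ($\mathrm{Inf}(c)$ iff $c\in M$, $\mathrm{Fin}(c)$ iff $c\notin M$). A generalized Rabin automaton with $k$ generalized Rabin pairs has $\mathit{Acc}=\bigvee_{0\le j<k}\big(\mathrm{Fin}(B_j)\wedge\bigwedge_{0\le l<m_j}\mathrm{Inf}(G_{j,l})\big)$; here $m_j\le\ell$ for all $j$. A generalized Büchi automaton with $k$ colours has $\mathit{Acc}=\bigwedge_{0\le j<k}\mathrm{Inf}(j)$. $\mathrm{tight}(n)$ is the number of functions $f:\{1,\dots,n\}\to\omega$ whose maximum $r$ is odd and whose image contains $\{1,3,\dots,r\}$.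
   Formalization: 0.76 is read as a rounding of the exact growth constant κ≈0.7645 of tight(n) (n-th-root sense); with 0.76 exact the second bound fails. It is proved as O(n^k(cℓn)^{nk}) for every c>κ and all large n. ℓ≥1 is assumed, as for ℓ=0 the first bound is 0. *)

(* Defs.v *)
From HB Require Import structures.
From mathcomp Require Import all_boot all_order all_algebra finmap.
From mathcomp Require Import all_classical all_reals all_analysis.

Set Implicit Arguments.
Unset Strict Implicit.
Unset Printing Implicit Defensive.

Import Order.TTheory GRing.Theory Num.Theory.
Import numFieldNormedType.Exports.

(* Acceptance formulae. AccTrue and AccFalse stand for the empty conjunction
   and the empty disjunction. *)
Inductive acc_formula (Gamma : Type) : Type :=
  | Inf of Gamma
  | Fin of Gamma
  | AccTrue
  | AccFalse
  | AccAnd of acc_formula Gamma & acc_formula Gamma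
  | AccOr of acc_formula Gamma & acc_formula Gamma.

Arguments AccTrue {Gamma}.
Arguments AccFalse {Gamma}.

Fixpoint acc_sat (Gamma : Type) (M : set Gamma) (phi : acc_formula Gamma) :
    Prop :=
  match phi with
  | Inf c => M c
  | Fin c => ~ M c
  | AccTrue => True
  | AccFalse => False
  | AccAnd phi1 phi2 => acc_sat M phi1 /\ acc_sat M phi2
  | AccOr phi1 phi2 => acc_sat M phi1 \/ acc_sat M phi2
  end.

(* The colouring is a total function on triples; its values outside
   el_delta are irrelevant, since runs only take transitions in el_delta. *)
Record el_automaton (Sigma Gamma : finType) := ELAutomaton {
  el_state : finType;
  el_delta : {set el_state * Sigma * el_state};
  el_init : {set el_state};
  el_colour : el_state * Sigma * el_state -> {set Gamma};
  el_acc : acc_formula Gamma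
}.

Local Open Scope classical_set_scope.

Definition run_transition (Sigma Gamma : finType) (A : el_automaton Sigma Gamma)
    (w : nat -> Sigma) (rho : nat -> el_state A)
    (i : nat) : el_state A * Sigma * el_state A :=
  (rho i, w i, rho i.+1).

Definition is_run (Sigma Gamma : finType) (A : el_automaton Sigma Gamma)
    (w : nat -> Sigma) (rho : nat -> el_state A) : Prop :=
  rho 0 \in el_init A /\ forall i, run_transition w rho i \in el_delta A.

Definition inf_transitions (Sigma Gamma : finType) (A : el_automaton Sigma Gamma)
    (w : nat -> Sigma) (rho : nat -> el_state A) :
    set (el_state A * Sigma * el_state A) :=
  [set t | forall N, exists2 i, N <= i & run_transition w rho i = t].

Definition inf_colours (Sigma Gamma : finType) (A : el_automaton Sigma Gamma)
    (w : nat -> Sigma) (rho : nat -> el_state A) :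
    set Gamma :=
  [set c | exists2 t, inf_transitions w rho t & c \in el_colour t].

Definition accepting_run (Sigma Gamma : finType) (A : el_automaton Sigma Gamma)
    (w : nat -> Sigma) (rho : nat -> el_state A) : Prop :=
  is_run w rho /\ acc_sat (inf_colours w rho) (el_acc A).

Definition language (Sigma Gamma : finType) (A : el_automaton Sigma Gamma) :
    set (nat -> Sigma) :=
  [set w | exists rho : nat -> el_state A, accepting_run w rho].

Local Close Scope classical_set_scope.

(* k generalized Rabin pairs with at most l Inf-atoms each; G j lists the
   colours G_(j,0), ..., G_(j,m_j - 1). *)
Definition is_generalized_rabin (Sigma Gamma : finType) (k l : nat)
    (A : el_automaton Sigma Gamma) : Prop :=
  exists (B : 'I_k -> Gamma) (G : 'I_k -> seq Gamma),
    (forall j, size (G j) <= l) /\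
    el_acc A = \big[@AccOr Gamma/AccFalse]_(j < k)
      AccAnd (Fin (B j)) (\big[@AccAnd Gamma/AccTrue]_(c <- G j) Inf c).

Definition is_generalized_buchi (Sigma : finType) (k : nat)
    (A : el_automaton Sigma 'I_k) : Prop :=
  el_acc A = \big[@AccAnd 'I_k/AccTrue]_(j < k) Inf j.

Definition tight_fun (n : nat) (f : {ffun 'I_n -> nat}) : Prop :=
  let r := \max_(i < n) f i in
  odd r /\ forall s, s <= r -> odd s -> exists i, f i = s.

(* fset_set returns the empty set on infinite sets; finite_tight_fun shows
   that this default is never used. *)
Definition tight (n : nat) : nat :=
  #|` fset_set [set f : {ffun 'I_n -> nat} | tight_fun f]%classic|%fset.

Lemma tight_fun_bound (n : nat) (f : {ffun 'I_n -> nat}) :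
  tight_fun f -> forall i, f i < n.*2.
Proof.
case=> r_odd hit i; set r := \max_(j < n) f j in r_odd hit.
have {}hit (s : 'I_r./2.+1) : exists j, f j == s.*2.+1.
  have [||j <-] := hit s.*2.+1; last by exists j.
    rewrite -[leqRHS]odd_double_half r_odd add1n ltnS leq_double.
    by rewrite -ltnS ltn_ord.
  by rewrite /= odd_double.
pose g s := xchoose (hit s).
have gE s : f (g s) = s.*2.+1 by apply/eqP; exact: xchooseP (hit s).
have g_inj : injective g.
  move=> s t est; have := gE s; rewrite est gE => -[/double_inj] e.
  exact/val_inj.
have := leq_card g g_inj; rewrite !card_ord => le_r.
have : f i <= r by exact: (leq_bigmax i).
rewrite -[r]odd_double_half r_odd add1n => /leq_ltn_trans; apply.
by rewrite -doubleS in le_r *; rewrite -leq_double in le_r.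
Qed.

Lemma finite_tight_fun (n : nat) :
  finite_set [set f : {ffun 'I_n -> nat} | tight_fun f]%classic.
Proof.
pose F (g : {ffun 'I_n -> 'I_(n.*2)}) : {ffun 'I_n -> nat} :=
  [ffun i => nat_of_ord (g i)].
apply: (@sub_finite_set _ _ (F @` setT)%classic).
  move=> f /tight_fun_bound fb; exists [ffun i => Ordinal (fb i)] => //.
  by apply/ffunP => i; rewrite !ffunE.
exact/finite_image/finite_finset.
Qed.

(* Agreement up to a factor (1 + o(1)) ^ n. The estimate 0.76 n for the n-th
   root of tight n holds in this sense, with 0.76 rounding the constant
   1 / (e ln ((1 + sqrt 5) / 2)) = 0.7644...; the quotient of tight n by
   (0.7644... n) ^ n is itself unbounded, of order sqrt n. *)
Definition exp_approx (R : realType) (f g : nat -> R) : Prop :=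
  ((fun n : nat => (f n / g n) `^ (n%:R^-1))%R @ \oo --> (1 : R)%R)%classic.

(* Main.v *)
Require Import Defs.
From HB Require Import structures.
From mathcomp Require Import all_boot all_order all_algebra finmap.
From mathcomp Require Import all_classical all_reals all_analysis.
From mathcomp Require Import zify ring lra.

Set Implicit Arguments.
Unset Strict Implicit.
Unset Printing Implicit Defensive.

Import Order.TTheory GRing.Theory Num.Theory.
Import numFieldNormedType.Exports.

(** A word is rejected iff, for every pair j, each infinite path of the run DAG
    without its B_j-transitions eventually avoids one of the colours G_(j,x).
    The vertices of this DAG are ranked by alternately removing those with
    finitely many descendants and those from which some G_(j,x) is unreachable;
    the removed vertices get an even rank, resp. an odd rank and the label x.
    The automaton runs the subset construction for a while and then guesses
    these k rankings, checking with breakpoints, for one even rank at a time,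
    that no path keeps this rank forever.

    As paths enter the DAG at every B_j-transition, the maximal rank of a level
    may stay even, so that the rankings themselves need not be tight: if all
    odd ranks below 2J occur, the ranks go up to 2J. Keeping only even ranks
    that still have an obligation leaves enough room to encode a ranking
    together with the obligations, the rank under scrutiny and the reached
    states by a single tight function on one more point.

    Splitting off the arguments of value at most 1 gives the renewal equation
    t(n) = sum_(e >= 1) C(n,e) (2^e - 1) t(n - e) for tight. Its weights
    (2^e - 1) y^e / e! have sum e^(2y) - e^y, which is 1 for y = ln phi, phi
    being the golden ratio; so tight(n) / n! is (1 / ln phi)^n up to
    subexponential factors. *)

(** * Rankings of layered graphs *)

Lemma dependent_choice (T : Type) (P : nat -> T -> Prop)
    (R : nat -> T -> T -> Prop) (t0 : nat) (a0 : T) :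
  P t0 a0 -> (forall t a, P t a -> exists b, P t.+1 b /\ R t a b) ->
  exists u : nat -> T, u 0 = a0 /\
    forall i, P (t0 + i) (u i) /\ R (t0 + i) (u i) (u i.+1).
Proof.
move=> P0 step.
(* The hypothesis moves below the existential, so that [choice] applies to all pairs; off [P] any
   value serves. *)
have {}step (x : nat * T) : exists b, P x.1 x.2 -> P x.1.+1 b /\ R x.1 x.2 b.
  have [/step[b bP]|nP] := pselect (P x.1 x.2); first by exists b.
  by exists x.2.
have [g gP] := choice step.
pose u := fix u i := if i is j.+1 then g (t0 + j, u j) else a0.
have uP i : P (t0 + i) (u i).
  elim: i => [|i IH]; first by rewrite addn0.
  by rewrite addnS; have [] := gP (t0 + i, u i) IH.
by exists u; split=> // i; split=> //; have [] := gP (t0 + i, u i) (uP i).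
Qed.

Lemma eventually_all (I : finType) (P : I -> nat -> Prop) :
  (forall i, exists N, forall t, N <= t -> P i t) ->
  exists N, forall i t, N <= t -> P i t.
Proof.
move=> /choice[N NP]; exists (\max_i N i) => i t le_t.
by apply: NP; apply: leq_trans le_t; exact: leq_bigmax.
Qed.

Section LayeredGraph.
Variables (Q : finType) (E : nat -> rel Q).
Implicit Types X Y : nat -> Q -> Prop.

Fixpoint has_path X N t q : Prop :=
  X t q /\ if N is N'.+1 then exists2 q', E t q q' & has_path X N' t.+1 q'
           else True.

(** Finite paths of every length stand for an infinite one; over a finite vertex set nothing is
    lost, by [alive_succ]. *)
Definition alive X t q := forall N, has_path X N t q.

Lemma has_path_leq X M N t q : M <= N -> has_path X N t q -> has_path X M t q.
Proof.
elim: M N t q => [|M IH] [|N] t q //= le_MN [Xq] // [q' e h].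
by split=> //; exists q' => //; exact: IH h.
Qed.

Lemma sub_has_path X Y N t q : (forall t q, X t q -> Y t q) ->
  has_path X N t q -> has_path Y N t q.
Proof.
move=> sXY; elim: N t q => [|N IH] t q /= [Xq h]; split=> //; try exact: sXY.
by case: h => q' e h; exists q' => //; exact: IH.
Qed.

Lemma alive_sub X t q : alive X t q -> X t q.
Proof. by move=> /(_ 0)[]. Qed.

(** König's lemma: if each successor had only paths of bounded length, the maximum of these finitely
    many bounds would also bound the paths from [q]. *)
Lemma alive_succ X t q : alive X t q ->
  exists2 q', E t q q' & alive X t.+1 q'.
Proof.
move=> aq; apply: contrapT => no.
have [N NP] : exists N, forall q' t', N <= t' ->
    E t q q' -> ~ has_path X t' t.+1 q'.
  apply: eventually_all => q'; have [e|ne] := boolP (E t q q');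
    last by exists 0.
  have /existsNP[N nN] : ~ alive X t.+1 q' by move=> aq'; apply: no; exists q'.
  by exists N => t' le_N _ /(has_path_leq le_N).
by have [_ [q' e]] := aq N.+1; exact: NP.
Qed.

Variables (l : nat) (mark : nat -> 'I_l -> rel Q).

Fixpoint unmarked X x N t q : Prop :=
  if N is N'.+1 then
    forall q', E t q q' -> X t.+1 q' ->
      ~~ mark t x q q' /\ unmarked X x N' t.+1 q'
  else True.

Definition avoids X x t q := forall N, unmarked X x N t q.

Lemma avoids_succ X x t q q' : avoids X x t q -> E t q q' -> X t.+1 q' ->
  ~~ mark t x q q' /\ avoids X x t.+1 q'.
Proof.
move=> av e Xq'; split; first by have [] := av 1 _ e Xq'.
by move=> N; have [] := av N.+1 _ e Xq'.
Qed.

(** Expresses rejection by one Rabin pair, its [Fin] part being built into the edge relation and its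
    [Inf] colours into the labels. *)
Definition fair_paths := forall t0 (p : nat -> Q),
  (forall t, E (t0 + t) (p t) (p t.+1)) ->
  exists x T, forall t, T <= t -> ~~ mark (t0 + t) x (p t) (p t.+1).

(* Otherwise one could build a path that serves the labels in round-robin
   order, taking an edge marked x whenever the label x is being served. *)
Lemma exists_avoids X t0 q0 : fair_paths -> X t0 q0 ->
  (forall t q, X t q -> exists2 q', E t q q' & X t.+1 q') ->
  exists t q x, X t q /\ avoids X x t q.
Proof.
move=> fair X0 Xsucc; apply: contrapT => no.
have {}no t q x : X t q -> exists N, ~ unmarked X x N t q.
  by move=> Xq; apply/existsNP => av; apply: no; exists t, q, x.
(* That there is a label at all follows from fairness, applied to an arbitrary path inside [X]. *)
have [x0] : exists x : 'I_l, True.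
  have [p [_ pP]] := @dependent_choice Q X (E : nat -> Q -> Q -> Prop) t0 q0 X0
    (fun t q Xq => let: ex_intro2 q' e X' := Xsucc t q Xq in
                   ex_intro _ q' (conj X' e)).
  by have [|x _] := fair t0 p; [move=> t; case: (pP t)|exists x].
move=> _; have [N0 N0P] := no _ _ x0 X0.
(* A state holds the current vertex, the label being served and a depth within which an edge with
   this label can be reached. The depth decreases until such an edge is taken; then the next label
   is served. *)
pose P t (a : Q * 'I_l * nat) := X t a.1.1 /\ ~ unmarked X a.1.2 a.2 t a.1.1.
pose R t (a b : Q * 'I_l * nat) := E t a.1.1 b.1.1 /\
  ((mark t a.1.2 a.1.1 b.1.1 /\ b.1.2 = ordS a.1.2) \/
   (b.1.2 = a.1.2 /\ b.2 < a.2)).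
have [|t a|u [_ uP]] := @dependent_choice _ P R t0 (q0, x0, N0); first by split.
  case: a => -[q x] [|N] [/= Xq nq]; first by case: nq.
  move/existsNP: nq => [q' /not_implyP[e /not_implyP[X' nm]]].
  have [m|m] := boolP (mark t x q q').
    have [M MP] := no _ _ (ordS x) X'; exists (q', ordS x, M).
    by split; [split | split=> //=; left].
  exists (q', x, N); split; last by split=> //=; right.
  by split=> // um; apply: nm.
have uR t : E (t0 + t) (u t).1.1 (u t.+1).1.1 by have [_ []] := uP t.
have serve N t : (u t).2 <= N -> exists t', [/\ t <= t',
    mark (t0 + t') (u t).1.2 (u t').1.1 (u t'.+1).1.1 &
    (u t'.+1).1.2 = ordS (u t).1.2].
  elim: N t => [|N IH] t le_N; have [_ [_ []]] := uP t; try by exists t; case.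
    by move=> [m e]; exists t.
    by case=> _ lt; lia.
    by move=> [m e]; exists t.
  move=> [ex lt]; have [|t' [le_t' m e]] := IH t.+1; first by lia.
  by exists t'; split; [lia | rewrite -ex | rewrite e ex].
have turn d t : exists2 t', t <= t' & (u t').1.2 = iter d (@ordS l) (u t).1.2.
  elim: d => [|d [t' le_t' IH]]; first by exists t.
  have [t'' [le_t'' _ e]] := serve _ _ (leqnn (u t').2).
  by exists t''.+1; [lia | rewrite e IH iterS].
have [x [T xP]] := fair t0 (fun t => (u t).1.1) uR.
(* [ordS] is cyclic: stepping up to [l] and then [x] times more ends in [x]. *)
have [d dx] : exists d, iter d (@ordS l) (u T).1.2 = x.
  exists (x + (l - (u T).1.2)); apply/val_inj.
  have vE d (y : 'I_l) : val (iter d (@ordS l) y) = (y + d) %% l.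
    elim: d => [|d IH] /=; first by rewrite addn0 modn_small.
    by rewrite IH -addn1 modnDml addn1 addnS.
  rewrite vE addnC -addnA subnK; last exact/ltnW.
  by rewrite addnC modnDl modn_small.
have [t le_t ex] := turn d T; have [t' [le_t' m _]] := serve _ _ (leqnn (u t).2).
by have /negP := xP t' (leq_trans le_t le_t'); apply; rewrite -dx -ex.
Qed.

Variable S : nat -> {set Q}.
Hypothesis E_in : forall t q q', E t q q' -> q \in S t /\ q' \in S t.+1.

Fixpoint layer s : nat -> Q -> Prop :=
  if s is s'.+1 then
    if odd s' then fun t q => layer s' t q /\ forall x, ~ avoids (layer s') x t q
    else alive (layer s')
  else fun t q => q \in S t.

Lemma layerS s t q : layer s.+1 t q -> layer s t q.
Proof. by move=> /=; case: (odd s) => [[]|/alive_sub]. Qed.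

Lemma layer_leq s s' t q : s <= s' -> layer s' t q -> layer s t q.
Proof.
move=> /subnK <-; elim: (s' - s) => // d IH.
by rewrite addSn => /layerS.
Qed.

(** A predecessor inherits arbitrarily long paths, and a label that it avoids is avoided by its
    successors too. Hence ranks never increase along an edge. *)
Lemma layer_pred s t q q' : E t q q' -> layer s t.+1 q' -> layer s t q.
Proof.
move=> e; elim: s => [|s IH]; first by have [] := E_in e.
move=> lq'; have {}IH := IH (layerS lq'); move: lq' => /=.
case: ifP => [_ [lq' nav]|_ alq'].
  by split=> // x /avoids_succ/(_ e lq')[_]; exact: nav.
by case=> [|N] /=; split=> //; exists q'.
Qed.

Lemma layer_succ s t q : odd s -> layer s t q ->
  exists2 q', E t q q' & layer s t.+1 q'.
Proof. by case: s => //= s /negbTE ->; exact: alive_succ. Qed.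

Hypothesis fair : fair_paths.

(** Some vertex of the layer avoids a label. So do its descendants in the layer, and these reach
    every later level because odd layers have no dead ends. *)
Lemma layer_persists s t0 q0 : odd s -> layer s t0 q0 ->
  exists T, forall t, T <= t -> exists q, layer s t q /\ ~ layer s.+1 t q.
Proof.
move=> s_odd l0.
have [t [q [x [lq av]]]] := exists_avoids fair l0 (fun t q => layer_succ s_odd).
exists t => t' /subnK <-.
suff [q' [lq' av']] : exists q', layer s (t' - t + t) q' /\
    avoids (layer s) x (t' - t + t) q'.
  by exists q'; split=> //=; rewrite s_odd => -[_]/(_ x).
elim: (t' - t) => [|d [q' [lq' av']]]; first by exists q.
have [q'' e lq''] := layer_succ s_odd lq'; exists q''.
by rewrite addSn; split=> //; have [] := avoids_succ av' e lq''.
Qed.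

(** Each nonempty layer of odd index loses a vertex on every late level, and vertices lost at
    different stages differ. On one late level this can happen at most [#|Q|] times. *)
Lemma layer_empty : exists2 J, J <= #|Q| &
  (forall t q, ~ layer J.*2.+1 t q) /\
  forall j, j < J -> exists t q, layer j.*2.+1 t q.
Proof.
pose ne J := `[< exists t q, layer J.*2.+1 t q >].
have exJ : exists2 J, J <= #|Q| & ~~ ne J.
  apply: contrapT => no.
  have {}no (j : 'I_#|Q|.+1) : exists T, forall t, T <= t ->
      exists q, layer j.*2.+1 t q /\ ~ layer j.*2.+2 t q.
    have [/asboolP[t [q lq]]|nj] := boolP (ne j); last first.
      by case: no; exists j => //; rewrite -ltnS.
    by apply: layer_persists lq; rewrite /= odd_double.
  have [T TP] := eventually_all no.
  have [g gP] := choice (fun j => TP j T (leqnn T)).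
  have g_inj : injective g.
    suff lt_g (i j : 'I_#|Q|.+1) : i < j -> g i <> g j.
      move=> i j gij; apply/val_inj.
      case: (ltngtP i j) => // /lt_g; [by rewrite gij|by rewrite -gij].
    move=> lt_ij gij; have [_] := gP i; rewrite gij; apply.
    by have [lj _] := gP j; apply: layer_leq lj; lia.
  by have := leq_card g g_inj; rewrite card_ord ltnn.
pose J := ex_minn (let: ex_intro2 J _ nJ := exJ in ex_intro _ J nJ).
exists J; rewrite /J; case: ex_minnP => m m_ne m_min {J}.
  by have [J le_J nJ] := exJ; exact: leq_trans (m_min _ nJ) le_J.
split=> [t q lq|j lt_j]; first by case/negP: m_ne; apply/asboolP; exists t, q.
suff /asboolP : ne j by [].
by apply: contraTT lt_j => /m_min; rewrite -leqNgt.
Qed.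

(* The rank of a vertex is the last layer containing it: vertices of even rank
   have only finitely many descendants of the same rank, those of odd rank have
   a label that no edge between descendants of the same rank carries. *)
Theorem ranking (x0 : 'I_l) :
  exists (f : nat -> Q -> nat) (lab : nat -> Q -> 'I_l) (J : nat),
  [/\ J <= #|Q|,
      forall t q, q \in S t -> f t q <= J.*2,
      exists T, forall t s, T <= t -> s < J.*2 -> odd s ->
        exists2 q, q \in S t & f t q = s,
      forall t q q', E t q q' -> f t.+1 q' <= f t q /\
        (f t.+1 q' = f t q -> odd (f t q) ->
         lab t.+1 q' <= lab t q /\ ~~ mark t (lab t q) q q') &
      forall t q, q \in S t -> ~~ odd (f t q) ->
        exists N,
          ~ has_path (fun t' q' => q' \in S t' /\ f t' q' = f t q) N t q].
Proof.
have [J le_J [J0 JP]] := layer_empty.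
have exf (v : nat * Q) : exists s, v.2 \in S v.1 ->
    [/\ s <= J.*2, layer s v.1 v.2 & ~ layer s.+1 v.1 v.2].
  case: v => t q /=; have [qS|nS] := boolP (q \in S t); last by exists 0.
  have ex : exists s, ~~ `[< layer s.+1 t q >].
    by exists J.*2; apply/asboolP/J0.
  exists (ex_minn ex) => _; case: ex_minnP => s /asboolP ns s_min; split=> //.
    by apply: s_min; apply/asboolP/J0.
  case: s ns s_min => // s ns s_min; apply: contrapT => ls.
  by have /asboolPn/s_min := ls; rewrite ltnn.
have [F FP] := choice exf; pose f t q := F (t, q).
have {FP exf} fP t q : q \in S t ->
    [/\ f t q <= J.*2, layer (f t q) t q & ~ layer (f t q).+1 t q].
  exact: FP (t, q).
have f_ge s t q : q \in S t -> layer s t q -> s <= f t q.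
  move=> /fP[_ _ nl] ls; rewrite leqNgt; apply/negP => lt_s.
  by apply: nl; apply: layer_leq ls.
(* Choosing the least avoided label makes labels nonincreasing along edges that keep an odd rank,
   since the successor avoids whatever the source avoids. *)
have exlab (v : nat * Q) : exists x : 'I_l, v.2 \in S v.1 ->
    odd (f v.1 v.2) -> avoids (layer (f v.1 v.2)) x v.1 v.2 /\
    forall y, avoids (layer (f v.1 v.2)) y v.1 v.2 -> x <= y.
  case: v => t q /=; set s := f t q.
  have [[y av]|no] := pselect (exists x, avoids (layer s) x t q); last first.
    (* A vertex of odd rank without an avoided label would survive into the next layer, so the
       default [x0] is never a real label. *)
    exists x0 => qS s_odd; have [_ lf []] := fP t q qS.
    by rewrite /= s_odd; split=> // x av; apply: no; exists x.
  exists [arg min_(z < y | `[< avoids (layer s) z t q >]) z] => _ _.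
  case: arg_minnP => [|z /asboolP avz z_min]; first exact/asboolP.
  by split=> // w /asboolP; exact: z_min.
have [L LP] := choice exlab; pose lab t q := L (t, q).
have {LP exlab} labP t q : q \in S t -> odd (f t q) ->
    avoids (layer (f t q)) (lab t q) t q /\
    forall y, avoids (layer (f t q)) y t q -> lab t q <= y.
  exact: LP (t, q).
exists f, lab, J; split=> //.
- by move=> t q /fP[].
- have /eventually_all[T TP] (j : 'I_J) : exists T, forall t, T <= t ->
      exists q, layer j.*2.+1 t q /\ ~ layer j.*2.+2 t q.
    have [t [q lq]] := JP j (ltn_ord j).
    by apply: layer_persists lq; rewrite /= odd_double.
  exists T => t s le_t lt_s s_odd.
  have lt_j : s./2 < J by lia.
  have sE : (Ordinal lt_j).*2.+1 = s by rewrite -[RHS]odd_double_half s_odd.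
  have [q] := TP (Ordinal lt_j) t le_t; rewrite sE => -[lq nlq].
  have qS : q \in S t by apply: (layer_leq (leq0n s)) lq.
  exists q => //; apply/eqP; rewrite eqn_leq f_ge // andbT leqNgt; apply/negP.
  by move=> lt; apply: nlq; have [_ lf _] := fP t q qS; exact: layer_leq lf.
- move=> t q q' e; have [qS q'S] := E_in e; have [_ lq' _] := fP _ _ q'S.
  split=> [|ff f_odd]; first exact/f_ge/(layer_pred e).
  have [av _] := labP t q qS f_odd; rewrite ff in lq'.
  have [nm av'] := avoids_succ av e lq'; split=> //.
  have f_odd' : odd (f t.+1 q') by rewrite ff.
  by have [_] := labP t.+1 q' q'S f_odd'; apply; rewrite ff.
- move=> t q qS f_even; have [_ lq nlq] := fP t q qS.
  move: nlq; rewrite /= (negbTE f_even) => /existsNP[N nN]; exists N.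
  apply: contra_not nN; apply: sub_has_path => t' q' [q'S fE].
  by have [_] := fP t' q' q'S; rewrite fE.
Qed.
End LayeredGraph.

(** * The complement automaton *)

Lemma acc_sat_big_or (Gamma : Type) (I : eqType) (M : set Gamma) (s : seq I)
    (F : I -> acc_formula Gamma) :
  acc_sat M (\big[@AccOr Gamma/AccFalse]_(i <- s) F i) <->
  exists2 i, i \in s & acc_sat M (F i).
Proof.
elim: s => [|i s IH]; first by rewrite big_nil; split=> //= -[].
rewrite big_cons /= IH; split=> [[sat|[j js sat]]|[j]].
- by exists i => //; rewrite mem_head.
- by exists j => //; rewrite in_cons js orbT.
- by rewrite in_cons => /predU1P[->|js sat]; [left|right; exists j].
Qed.

Lemma acc_sat_big_and (Gamma : Type) (I : eqType) (M : set Gamma) (s : seq I)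
    (F : I -> acc_formula Gamma) :
  acc_sat M (\big[@AccAnd Gamma/AccTrue]_(i <- s) F i) <->
  forall i, i \in s -> acc_sat M (F i).
Proof.
elim: s => [|i s IH]; first by rewrite big_nil; split.
rewrite big_cons /= IH; split=> [[sat sats] j|sats].
  by rewrite in_cons => /predU1P[->|/sats].
by split=> [|j js]; apply: sats; rewrite in_cons ?eqxx ?js ?orbT.
Qed.

(** A colour seen infinitely often lies on some transition taken infinitely often, because there are
    only finitely many transitions. *)
Lemma inf_coloursP (Sigma Gamma : finType) (A : el_automaton Sigma Gamma)
    (w : nat -> Sigma) (rho : nat -> el_state A) (c : Gamma) :
  inf_colours w rho c <->
  forall N, exists2 i, N <= i & c \in el_colour (run_transition w rho i).
Proof.
split=> [[t tinf ct] N|io].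
  by have [i le_i it] := tinf N; exists i; rewrite ?it.
apply: contrapT => no.
have [N NP] : exists N, forall t i, N <= i -> c \in el_colour t ->
    run_transition w rho i <> t.
  apply: eventually_all => t; have [ct|nct] := boolP (c \in el_colour t).
    have /existsNP[N nN] : ~ inf_transitions w rho t.
      by move=> ti; apply: no; exists t.
    by exists N => i le_i _ it; apply: nN; exists i.
  by exists 0 => i _.
by have [i le_i ci] := io N; exact: NP le_i ci erefl.
Qed.

Lemma nonincreasing_eventually_constant (u : nat -> nat) (T : nat) :
  (forall t, T <= t -> u t.+1 <= u t) ->
  exists T' e, T <= T' /\ forall t, T' <= t -> u t = e.
Proof.
move=> u_ni; have [m] := ubnP (u T); elim: m T u_ni => // m IH T u_ni lt_m.
have [[t le_t lt_t]|no] := pselect (exists2 t, T <= t & u t < u T).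
  have [||T' [e [le_T' eP]]] := IH t; [by move=> t' ?; apply: u_ni; lia|lia|].
  by exists T', e; split=> //; lia.
exists T, (u T); split=> // t /subnK <-; elim: (t - T) => // d IHd.
apply/eqP; rewrite addSn eqn_leq -{1}IHd u_ni ?leq_addl //= leqNgt.
by apply/negP => lt_d; apply: no; exists (d + T).+1; lia.
Qed.

Lemma bounded_not_increasing (u : nat -> nat) (T M : nat) :
  (forall t, u t <= M) -> (forall t, T <= t -> u t <= u t.+1) ->
  ~ forall N, exists2 t, N <= t & u t < u t.+1.
Proof.
move=> u_le u_nd io.
have [|T' [e [_ eP]]] := @nonincreasing_eventually_constant (fun t => M - u t) T.
  by move=> t /u_nd; lia.
have [t le_t lt_t] := io T'; have := eP t le_t; have := eP t.+1 (leqW le_t).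
by have := u_le t; have := u_le t.+1; lia.
Qed.

Lemma card_set_type (T : finType) : #|{set T}| = 2 ^ #|T|.
Proof.
rewrite -[in RHS]cardsT -card_powerset; apply: eq_card => P.
by rewrite !inE finset.subsetT.
Qed.

Section Complement.
Variables (Sigma Gamma : finType) (A : el_automaton Sigma Gamma) (k l : nat).
Variables (b : 'I_k -> Gamma) (G : 'I_k -> seq Gamma).
Local Notation Q := (el_state A).
Implicit Types (P : {set Q}) (sigma : Sigma) (j : 'I_k) (w : nat -> Sigma).

Definition post P sigma :=
  [set q' | [exists q in P, (q, sigma, q') \in el_delta A]].

Lemma mem_post P sigma q q' :
  q \in P -> (q, sigma, q') \in el_delta A -> q' \in post P sigma.
Proof. by move=> qP d; rewrite inE; apply/exists_inP; exists q. Qed.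

Fixpoint reached w t :=
  if t is t'.+1 then post (reached w t') (w t') else el_init A.

Lemma reached_run w t q : q \in reached w t -> exists rho : nat -> Q,
  [/\ rho t = q, rho 0 \in el_init A &
      forall i, i < t -> run_transition w rho i \in el_delta A].
Proof.
elim: t q => [|t IH] q /=; first by exists (fun=> q).
rewrite inE => /exists_inP[p /IH[rho [rt r0 rS]] d].
exists (fun i => if i <= t then rho i else q); split; rewrite ?ltnn //.
move=> i; rewrite ltnS leq_eqVlt /run_transition => /predU1P[->|lt_i].
  by rewrite leqnn ltnn rt.
by rewrite (ltnW lt_i) lt_i; exact: rS.
Qed.

(* Ranks, labels of the states of odd rank, obligations (states of rank ix that
   still have to leave this rank), and the even rank ix under scrutiny. *)
Definition component : finType :=
  ({ffun Q -> 'I_(#|Q|.*2.+1)} * {ffun Q -> 'I_l} * {set Q}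
    * 'I_(#|Q|.*2.+1))%type.
Implicit Types c : component.

Definition rk c q : nat := c.1.1.1 q.
Definition lb c q : 'I_l := c.1.1.2 q.
Definition ob c : {set Q} := c.1.2.
Definition ix c : nat := c.2.

(** Rank 0 outside [P] is a normal form, needed for decoding. Obligations may be empty only if no
    even rank occurs in [P], and then [ix c] is pinned to [J.*2]; this is what lets the code of a
    component fit into a tight function. *)
Definition valid_at J P c : Prop :=
  [/\ J <= #|Q|,
      forall q, q \in P -> rk c q <= J.*2,
      forall s, s < J.*2 -> odd s -> exists2 q, q \in P & rk c q = s &
      forall q, q \notin P -> rk c q = 0] /\
  [/\ forall q, q \in ob c -> q \in P /\ rk c q = ix c,
      ~~ odd (ix c), ix c <= J.*2 &
      ob c = finset.set0 -> ix c = J.*2 /\ forall q, q \in P -> odd (rk c q)].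

Definition valid P c : Prop := exists J, valid_at J P c.

Definition safe_edge j sigma (q q' : Q) :=
  ((q, sigma, q') \in el_delta A) && (b j \notin el_colour (q, sigma, q')).

(** Labels beyond the end of [G j] are marked on every edge and so are never avoided; thus all pairs
    can share the label type ['I_l]. *)
Definition marked j sigma (x : 'I_l) (q q' : Q) :=
  (x < size (G j)) ==> (nth (b j) (G j) x \in el_colour (q, sigma, q')).

Definition rank_step j P sigma c c' : Prop :=
  forall q q', q \in P -> safe_edge j sigma q q' ->
    rk c' q' <= rk c q /\
    (rk c' q' = rk c q -> odd (rk c q) ->
     lb c' q' <= lb c q /\ ~~ marked j sigma (lb c q) q q').

Definition carry j c sigma c' :=
  [set q' | (rk c' q' == ix c) && [exists q in ob c, safe_edge j sigma q q']].

(* ix c' is the even rank occurring in P that follows i cyclically. *)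
Definition next_ix P i c' : Prop :=
  forall q, q \in P -> ~~ odd (rk c' q) ->
    (i < ix c' -> rk c' q <= i \/ ix c' <= rk c' q) /\
    (ix c' <= i -> ix c' <= rk c' q <= i).

Definition ob_step j P' sigma c c' : Prop :=
  if carry j c sigma c' == finset.set0 then
    ob c' = [set q in P' | rk c' q == ix c'] /\ next_ix P' (ix c) c'
  else ob c' = carry j c sigma c' /\ ix c' = ix c.

(** The left summand is the subset construction before the guess; the right one holds one ranking
    per pair over a common reached set. Validity is part of the type, since it is what bounds the
    number of states. *)
Definition macro_state : finType :=
  ({set Q} + {x : {set Q} * {ffun 'I_k -> component} |
              `[< forall j, valid x.1 (x.2 j) >]})%type.

Definition macro_step (x : macro_state) sigma (y : macro_state) : Prop :=
  match x, y with
  | inl P, inl P' => P' = post P sigma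
  | inl P, inr y => (val y).1 = post P sigma
  | inr x, inr y => (val y).1 = post (val x).1 sigma /\
      forall j, rank_step j (val x).1 sigma ((val x).2 j) ((val y).2 j) /\
        ob_step j (val y).1 sigma ((val x).2 j) ((val y).2 j)
  | inr _, inl _ => False
  end.

Definition macro_colour (t : macro_state * Sigma * macro_state) : {set 'I_k} :=
  if t is (inr x, sigma, inr y) then
    [set j | carry j ((val x).2 j) sigma ((val y).2 j) == finset.set0]
  else finset.set0.

Definition complement_automaton : el_automaton Sigma 'I_k :=
  ELAutomaton [set t | `[< macro_step t.1.1 t.1.2 t.2 >]]
    [set inl (el_init A)] macro_colour
    (\big[@AccAnd 'I_k/AccTrue]_(j < k) Inf j).

(** Soundness for one pair. The rank along the path becomes a constant [e]. If [e] is odd, the label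
    becomes constant as well and is never marked again, against the recurrence of all labels. If [e]
    is even, breakpoints put [e] under scrutiny or else drive [ix] up forever. *)
Lemma component_sound j w (P : nat -> {set Q}) (c : nat -> component)
    (rho : nat -> Q) :
  (forall t, rho t \in P t) ->
  (forall t, safe_edge j (w t) (rho t) (rho t.+1)) ->
  (forall t, rank_step j (P t) (w t) (c t) (c t.+1) /\
             ob_step j (P t.+1) (w t) (c t) (c t.+1)) ->
  (forall x N, exists2 t, N <= t & marked j (w t) x (rho t) (rho t.+1)) ->
  ~ forall N, exists2 t, N <= t & carry j (c t) (w t) (c t.+1) = finset.set0.
Proof.
move=> rhoP safe step marks brk.
have rkS t : rk (c t.+1) (rho t.+1) <= rk (c t) (rho t).
  by have [/(_ _ _ (rhoP t) (safe t))[]] := step t.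
have [T [e [_ eP]]] := @nonincreasing_eventually_constant
  (fun t => rk (c t) (rho t)) 0 (fun t _ => rkS t).
have [e_odd|e_even] := boolP (odd e).
  have lbS t : T <= t -> lb (c t.+1) (rho t.+1) <= lb (c t) (rho t) /\
      ~~ marked j (w t) (lb (c t) (rho t)) (rho t) (rho t.+1).
    move=> le_t; have [/(_ _ _ (rhoP t) (safe t))[_ H] _] := step t.
    by apply: H; rewrite !eP ?leqW.
  have [T' [x [le_T' xP]]] := @nonincreasing_eventually_constant
    (fun t => val (lb (c t) (rho t))) T (fun t le_t => (lbS t le_t).1).
  have [t le_t] := marks (lb (c T') (rho T')) T'; apply/negP.
  have [_] := lbS t (leq_trans le_T' le_t).
  by congr (~~ marked _ _ _ _ _); apply/val_inj; rewrite !xP.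
(* If a breakpoint selects [e], the path becomes an obligation and remains one, so that no later
   breakpoint is possible. *)
have not_e t : T <= t -> carry j (c t) (w t) (c t.+1) = finset.set0 ->
    ix (c t.+1) <> e.
  move=> le_t brk_t ixe.
  have [t' /subnK le_t' brk_t'] := brk t.+1.
  suff /(_ (t' - t.+1))[rho_ob ix_e] : forall d,
      rho (d + t.+1) \in ob (c (d + t.+1)) /\ ix (c (d + t.+1)) = e.
    move: brk_t'; rewrite le_t' in rho_ob ix_e => /finset.setP/(_ (rho t'.+1)).
    rewrite finset.in_set0 inE ix_e eP ?eqxx; last by lia.
    by move=> /= /negbT/exists_inP; apply; exists (rho t').
  elim=> [|d [rho_ob ix_e]]; rewrite ?add0n ?addSn.
    have [_] := step t; rewrite /ob_step brk_t eqxx => -[-> _]; split=> //.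
    by rewrite inE rhoP ixe eP ?eqxx //; lia.
  have : rho (d + t.+1).+1 \in
      carry j (c (d + t.+1)) (w (d + t.+1)) (c (d + t.+1).+1).
    rewrite inE ix_e eP ?eqxx; last by lia.
    by apply/exists_inP; exists (rho (d + t.+1)).
  have [_] := step (d + t.+1); rewrite /ob_step; case: ifP => [/eqP->|_].
    by rewrite inE.
  by move=> [-> ->].
have ix_stay t : carry j (c t) (w t) (c t.+1) <> finset.set0 ->
    ix (c t.+1) = ix (c t).
  by move=> /eqP/negbTE nb; have [_] := step t; rewrite /ob_step nb => -[].
have ix_next t : T <= t -> carry j (c t) (w t) (c t.+1) = finset.set0 ->
    (ix (c t) < ix (c t.+1) -> e <= ix (c t) \/ ix (c t.+1) <= e) /\
    (ix (c t.+1) <= ix (c t) -> ix (c t.+1) <= e <= ix (c t)).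
  move=> le_t brk_t; have [_] := step t.
  rewrite /ob_step brk_t eqxx => -[_ /(_ _ (rhoP t.+1))].
  by rewrite !eP ?leqW //; apply.
have ix_le t : ix (c t) <= #|Q|.*2 by rewrite -ltnS ltn_ord.
(* The cyclic order cannot skip [e], which occurs on the path. Hence [ix] stays on one side of [e]
   and grows at each breakpoint, although it is bounded. *)
have [[t0 le_t0 lt_t0]|no] := pselect (exists2 t, T <= t & ix (c t) < e).
  have lt_e t : t0 <= t -> ix (c t) < e.
    move=> /subnK <-; elim: (t - t0) => // d IH; rewrite addSn.
    have [bd|/ix_stay -> //] := pselect (carry j (c (d + t0)) (w (d + t0))
      (c (d + t0).+1) = finset.set0).
    have le_d : T <= d + t0 by lia.
    by have := ix_next _ le_d bd; have := not_e _ le_d bd; lia.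
  apply: (@bounded_not_increasing _ t0 _ ix_le) => [t le_t|N].
    have [bd|/ix_stay -> //] := pselect (carry j (c t) (w t) (c t.+1) = finset.set0).
    by have := lt_e t le_t; have := ix_next t _ bd; lia.
  have [t le_t bd] := brk (maxn N t0); exists t; first by lia.
  have le_t' : T <= t by lia.
  by have := lt_e t; have := ix_next t le_t' bd; lia.
have ge_e t : T <= t -> e <= ix (c t).
  by move=> le_t; rewrite leqNgt; apply/negP => lt; apply: no; exists t.
apply: (@bounded_not_increasing _ T _ ix_le) => [t le_t|N].
  have [bd|/ix_stay -> //] := pselect (carry j (c t) (w t) (c t.+1) = finset.set0).
  have := ix_next t le_t bd; have := not_e t le_t bd.
  by have := ge_e t.+1 (leqW le_t); lia.
have [t le_t bd] := brk (maxn N T); exists t; first by lia.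
have le_t' : T <= t by lia.
have := ix_next t le_t' bd; have := not_e t le_t' bd.
by have := ge_e t.+1 (leqW le_t'); lia.
Qed.
Hypothesis accA : el_acc A = \big[@AccOr Gamma/AccFalse]_(j < k)
  AccAnd (Fin (b j)) (\big[@AccAnd Gamma/AccTrue]_(g <- G j) Inf g).

Lemma accepting_runP w (rho : nat -> Q) : accepting_run w rho <->
  is_run w rho /\ exists j,
    (exists T, forall t, T <= t -> b j \notin el_colour (run_transition w rho t)) /\
    forall g, g \in G j -> forall N, exists2 t, N <= t &
      g \in el_colour (run_transition w rho t).
Proof.
rewrite /accepting_run accA acc_sat_big_or; split=> -[run].
  case=> j _ [/= /inf_coloursP nb /acc_sat_big_and inf]; split=> //; exists j.
  split; last by move=> g /inf /= /inf_coloursP.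
  move/existsNP: nb => [T nT]; exists T => t le_t; apply/negP => bt.
  by apply: nT; exists t.
case=> j [[T nb] inf]; split=> //; exists j; rewrite ?mem_index_enum //=; split.
  by move=> /inf_coloursP/(_ T)[t le_t]; apply/negP/nb.
by apply/acc_sat_big_and => g gG /=; apply/inf_coloursP; exact: inf.
Qed.

Lemma complement_sound w :
  language complement_automaton w -> ~ language A w.
Proof.
move=> [R [[R0 RS] /acc_sat_big_and Racc]].
move=> [rho /accepting_runP[rho_run [j [[T0 nb] inf]]]].
have {Racc} brk N : exists2 t, N <= t & j \in macro_colour (R t, w t, R t.+1).
  have /(_ N) := (inf_coloursP _ _ _).1 (Racc j (mem_index_enum _)); exact.
have {}RS t : macro_step (R t) (w t) (R t.+1).
  by have := RS t; rewrite inE => /asboolP.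
(* Only transitions between ranking states carry colours, so the run must leave the subset phase. *)
have [T le_T [x Rx]] : exists2 T, T0 <= T & exists x, R T = inr x.
  have [T le_T bT] := brk T0; exists T => //; move: bT.
  by rewrite /=; case: (R T) => [P|x]; [rewrite inE|exists x].
have {Rx} /choice[y yP] t : exists y, R (T + t) = inr y.
  elim: t => [|t [y Ry]]; first by rewrite addn0; exists x.
  rewrite addnS; have := RS (T + t); rewrite Ry.
  by case: (R (T + t).+1) => [P|z] //= _; exists z.
have mem_P t : rho (T + t) \in (val (y t)).1.
  (* Stated for both kinds of macro state at once, so that the induction passes through the
     guess. *)
  suff h s P : (if R s is inr z then (val z).1 = P else
      if R s is inl P' then P' = P else True) -> rho s \in P.
    by apply: (h (T + t)); rewrite yP.
  elim: s P => [|s IH] P.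
    move: R0; rewrite inE => /eqP -> <-; exact: rho_run.1.
  have d := rho_run.2 s; have := RS s; case: (R s) IH => [P1|z1] IH.
    case: (R s.+1) => [P2|z2] /= -> <-; exact: (mem_post (IH _ _) d).
  by case: (R s.+1) => [P2|z2] //= [-> _] <-; exact: (mem_post (IH _ _) d).
apply: (@component_sound j (fun t => w (T + t)) (fun t => (val (y t)).1)
  (fun t => (val (y t)).2 j) (fun t => rho (T + t))) => //=.
- move=> t; rewrite addnS /safe_edge rho_run.2 nb //; lia.
- by move=> t; have := RS (T + t); rewrite -addnS !yP => -[_]/(_ j).
- move=> z N; have [lt_z|ge_z] := ltnP z (size (G j)); last first.
    by exists N => //; rewrite /marked ltnNge ge_z.
  have [t le_t ct] := inf _ (mem_nth (b j) lt_z) (T + N).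
  exists (t - T); first by lia.
  by rewrite addnS subnKC ?lt_z; [rewrite /marked lt_z | lia].
- move=> N; have [t le_t] := brk (T + N); have [d tE] : exists d, t = T + d.
    by exists (t - T); lia.
  rewrite tE -addnS !yP /= inE => /eqP c0; exists d => //; lia.
Qed.

(** * Completeness: an accepting run of the complement automaton on a rejected word *)

Section Complete.
Variables (x0 : 'I_l) (w : nat -> Sigma).
Hypotheses (nLw : ~ language A w) (leG : forall j, size (G j) <= l).

Let E j t : rel Q := fun q q' => (q \in reached w t) && safe_edge j (w t) q q'.

Lemma E_reached j t q q' :
  E j t q q' -> q \in reached w t /\ q' \in reached w t.+1.
Proof. by move=> /andP[qS /andP[d _]]; split=> //; exact: mem_post d. Qed.

(** An infinite path of safe edges, preceded by a run leading to its start, is a run of [A] that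
    meets [b j] finitely often. As the word is rejected, some colour of [G j] recurs only finitely
    often; its index is the label. *)
Lemma component_fair j : fair_paths (E j) (fun t x => marked j (w t) x).
Proof.
move=> t0 p pE; have pd t := andP (pE t).
have [rho [rt r0 rS]] : exists rho : nat -> Q, [/\ rho t0 = p 0,
    rho 0 \in el_init A & forall i, i < t0 -> run_transition w rho i \in el_delta A].
  by apply: reached_run; rewrite -[t0]addn0; case: (pd 0).
pose r i := if i < t0 then rho i else p (i - t0).
have rp t : r (t0 + t) = p t by rewrite /r ltnNge leq_addr addKn.
have r_run : is_run w r.
  split=> [|i].
    rewrite /r; case: ltnP => // t00; rewrite sub0n -rt.
    by move: t00; rewrite leqn0 => /eqP ->.
  have [lt_i|le_i] := ltnP i t0; last first.
    rewrite -(subnKC le_i) /run_transition -addnS !rp.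
    by have [_ /andP[]] := pd (i - t0).
  have := rS i lt_i; rewrite /run_transition /r lt_i.
  case: ltnP => // le_t0; have -> : i.+1 = t0 by lia.
  by rewrite subnn rt.
apply: contrapT => no; apply: nLw; exists r; apply/accepting_runP; split=> //.
exists j; split.
  exists t0 => t le_t; rewrite -(subnKC le_t) /run_transition -addnS !rp.
  by have [_ /andP[]] := pd (t - t0).
move=> g gG N; apply: contrapT => noc; apply: no.
have lt_c : index g (G j) < l by apply: leq_trans (leG j); rewrite index_mem.
exists (Ordinal lt_c), N => t le_t; rewrite /marked /= index_mem gG /= nth_index //.
apply/negP => ct; apply: noc; exists (t0 + t); first by lia.
by rewrite /run_transition -addnS !rp.
Qed.

(** The index is the least even rank of [P] above [i], failing that the least even rank of [P],
    failing that [J.*2]. *)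
Lemma exists_next_ix P J (f : {ffun Q -> 'I_(#|Q|.*2.+1)})
    (g : {ffun Q -> 'I_l}) i :
  J <= #|Q| -> (forall q, q \in P -> f q <= J.*2) ->
  (forall s, s < J.*2 -> odd s -> exists2 q, q \in P & f q = s :> nat) ->
  (forall q, q \notin P -> f q = 0 :> nat) ->
  exists c : component, [/\ c.1.1 = (f, g), valid_at J P c,
    ob c = [set q in P | rk c q == ix c] & next_ix P i c].
Proof.
move=> le_J f_le f_odd f_out.
pose ev s := ~~ odd s && [exists q in P, f q == s :> nat].
have mk s : ~~ odd s -> s <= J.*2 -> (~~ ev s -> s = J.*2 /\ forall t, ~~ ev t) ->
    exists c : component, [/\ c.1.1 = (f, g), valid_at J P c,
      ob c = [set q in P | rk c q == ix c] & ix c = s].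
  move=> s_ev le_s sP; pose O := [set q in P | f q == s :> nat].
  exists (f, g, O, inord s); have lt_s : s < #|Q|.*2.+1 by lia.
  rewrite /valid_at /ob /rk /ix /= inordK //.
  split=> //; split=> //; split=> //.
  - by move=> q; rewrite inE => /andP[qP /eqP].
  - move=> O0; have [|sJ nev] := sP.
      apply/negP => /andP[_ /exists_inP[q qP fq]].
      by have := finset.in_set0 q; rewrite -O0 inE qP fq.
    split=> // q qP; apply: contraT => q_ev.
    by have := nev (f q); rewrite /ev q_ev /= => /exists_inP[]; exists q.
have evP q : q \in P -> ~~ odd (f q) -> ev (f q).
  by move=> qP f_ev; rewrite /ev f_ev; apply/exists_inP; exists q.
have ev_le s : ev s -> ~~ odd s /\ s <= J.*2.
  by move=> /andP[s_ev /exists_inP[q /f_le le_q /eqP fq]]; rewrite -fq in s_ev *.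
have [ex|no] := pselect (exists s, (i < s) && ev s).
  case: (ex_minnP ex) => m /andP[lt_m ev_m] m_min.
  have [m_even le_m] := ev_le m ev_m.
  have [|c [cE cv cO cm]] := mk m m_even le_m; first by rewrite ev_m.
  exists c; split=> // q qP; rewrite /rk cE cm /= => /(evP q qP) ev_q.
  split=> [_|]; last by lia.
  by case: (leqP (f q) i) => lt_i; [left|right; apply: m_min; rewrite lt_i].
have {}no s : ev s -> s <= i.
  by move=> ev_s; rewrite leqNgt; apply/negP => lt; apply: no; exists s; rewrite lt.
(* Nothing even lies above [i], so the search wraps around to the least even rank. *)
have [ex|no'] := pselect (exists s, ev s).
  case: (ex_minnP ex) => m ev_m m_min.
  have [m_even le_m] := ev_le m ev_m.
  have [|c [cE cv cO cm]] := mk m m_even le_m; first by rewrite ev_m.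
  exists c; split=> // q qP; rewrite /rk cE cm /= => /(evP q qP) ev_q.
  by have le_q := m_min _ ev_q; split=> _; [right|rewrite le_q no].
have [||_|c [cE cv cO cm]] := mk J.*2; rewrite ?odd_double //.
  by split=> // t; apply/negP => ev_t; apply: no'; exists t.
exists c; split=> // q qP; rewrite /rk cE /= => /(evP q qP) ev_q.
by case: no'; exists (f q).
Qed.

(** The ranks and labels come from [ranking]; only index and obligations are built step by step. Any
    late start is allowed, so that all pairs can start together. *)
Lemma component_complete j : exists T, forall T0, T <= T0 ->
  exists c : nat -> component,
    [/\ forall i, valid (reached w (T0 + i)) (c i),
        forall i, rank_step j (reached w (T0 + i)) (w (T0 + i)) (c i) (c i.+1) /\
          ob_step j (reached w (T0 + i).+1) (w (T0 + i)) (c i) (c i.+1) &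
        forall N, exists2 i, N <= i &
          carry j (c i) (w (T0 + i)) (c i.+1) = finset.set0].
Proof.
have [f [lab [J [le_J f_le [T f_odd] f_step f_even]]]] :=
  ranking (@E_reached j) (@component_fair j) x0.
exists T => T0 le_T.
pose F t : {ffun Q -> 'I_(#|Q|.*2.+1)} :=
  [ffun q => inord (if q \in reached w t then f t q else 0)].
pose L t : {ffun Q -> 'I_l} := [ffun q => lab t q].
have FE t q : F t q = (if q \in reached w t then f t q else 0) :> nat.
  rewrite ffunE inordK //; case: ifP => // /f_le; lia.
have nextP t i : T <= t -> exists c : component,
    [/\ c.1.1 = (F t, L t), valid_at J (reached w t) c,
    ob c = [set q in reached w t | rk c q == ix c] & next_ix (reached w t) i c].
  move=> le_t; apply: exists_next_ix => // [q qS|s lt_s s_odd|q /negbTE qS].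
  - by rewrite FE qS f_le.
  - have [q qS fq] := f_odd t s le_t lt_s s_odd.
    by exists q => //; rewrite FE qS.
  - by rewrite FE qS.
pose Pc t (c : component) := [/\ T <= t, c.1.1 = (F t, L t) &
  valid_at J (reached w t) c].
pose Rc t c c' := ob_step j (reached w t.+1) (w t) c c'.
have [c0 [c0E c0v _ _]] := nextP T0 0 le_T.
have [|t c [le_t cE cv]|c [_ cP]] := @dependent_choice _ Pc Rc T0 c0.
- by split.
- have [c1 [c1E c1v c1O c1n]] := nextP t.+1 (ix c) (leqW le_t).
  (* [carry] reads only the ranks of its last argument, so it has the same value for [c1] and for
     the component [c'] with the old index. *)
  have [C0|Cn0] := eqVneq (carry j c (w t) c1) finset.set0.
    exists c1; split; first by split=> //; exact: leqW.
    by rewrite /Rc /ob_step C0 eqxx.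
  pose c' : component := (c1.1.1, carry j c (w t) c1, c.2).
  exists c'; split.
    split=> //; first exact: leqW.
    have [[_ le1 odd1 out1] _] := c1v; have [_ [ob_c ix_even ix_le _]] := cv.
    split=> //; split=> // [q|]; last by move/eqP; rewrite (negbTE Cn0).
    rewrite inE => /andP[/eqP rkq /exists_inP[p /ob_c[pS _] /andP[d _]]].
    by split=> //; exact: mem_post d.
  by rewrite /Rc /ob_step; case: ifP => // /idPn; rewrite Cn0.
have rkE i q : q \in reached w (T0 + i) -> rk (c i) q = f (T0 + i) q.
  by move=> qS; have [[_ cE _] _] := cP i; rewrite /rk cE /= FE qS.
have lbE i q : lb (c i) q = lab (T0 + i) q.
  by have [[_ cE _] _] := cP i; rewrite /lb cE /= ffunE.
exists c; split.
- by move=> i; exists J; have [[]] := cP i.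
- move=> i; split; last by have [_] := cP i.
  move=> q q' qS e; have Ee : E j (T0 + i) q q' by rewrite /E qS.
  have [_ q'S] := E_reached Ee; have [le_f odd_f] := f_step _ _ _ Ee.
  rewrite (rkE i) // !lbE addnS in odd_f *.
  by rewrite (rkE i.+1) addnS.
(* Without breakpoints after [N] the obligations never die out. Traced back to time [N], they yield
   arbitrarily long paths of one even rank, whereas the lengths of such paths from the finitely many
   obligations are bounded. *)
- move=> N; apply: contrapT => no.
  have stay i : N <= i -> [/\ carry j (c i) (w (T0 + i)) (c i.+1) != finset.set0,
      ob (c i.+1) = carry j (c i) (w (T0 + i)) (c i.+1) & ix (c i.+1) = ix (c i)].
    move=> le_i; have [|Cn0] := eqVneq (carry j (c i) (w (T0 + i)) (c i.+1))
      finset.set0; first by move=> C0; case: no; exists i.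
    by have [_] := cP i; rewrite /Rc /ob_step (negbTE Cn0) => -[].
  have ixE i : N <= i -> ix (c i) = ix (c N).
    move=> /subnK <-; elim: (i - N) => // d IH.
    by rewrite addSn; have [|_ _ ->] := stay (d + N); first by lia.
  set e := ix (c N) in ixE.
  pose X t q := q \in reached w t /\ f t q = e.
  have back d i q' : N <= i -> q' \in ob (c (i + d)) ->
      exists2 q, q \in ob (c i) & has_path (E j) X d (T0 + i) q.
    have obX i' q : N <= i' -> q \in ob (c i') -> X (T0 + i') q.
      move=> le_i; have [[_ _ [_ [ob_c _ _ _]]] _] := cP i'.
      by move=> /ob_c[qS]; rewrite rkE // ixE.
    elim: d i q' => [|d IH] i q' le_i q'O.
      by exists q'; rewrite addn0 // in q'O *; split=> //; exact: obX.
    have [|q1 q1O h] := IH i.+1 q' (leqW le_i); first by rewrite addSn -addnS.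
    have [_ obE _] := stay i le_i; move: (q1O); rewrite obE inE.
    move=> /andP[_ /exists_inP[q qO e1]]; exists q => //=; split; first exact: obX.
    exists q1; last by rewrite -addnS.
    by rewrite /E e1 andbT; have [] := obX i q le_i qO.
  have dead q : exists M, forall M', M <= M' ->
      q \in ob (c N) -> ~ has_path (E j) X M' (T0 + N) q.
    have [qO|nO] := boolP (q \in ob (c N)); last by exists 0.
    have [[_ _ [_ [ob_c ix_even _ _]]] _] := cP N.
    have [qS rkq] := ob_c q qO; rewrite rkE // in rkq.
    have := f_even (T0 + N) q qS; rewrite rkq => /(_ ix_even)[M nM].
    by exists M => M' le_M _ /(has_path_leq le_M).
  have [M MP] := eventually_all dead.
  have [|Cn0 obE _] := stay (N + M); first exact: leq_addr.
  have /set0Pn[q'] := Cn0; rewrite -obE -addnS => q'O.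
  have [q qO h] := back _ _ _ (leqnn N) q'O.
  exact: MP (leqnSn M) qO h.
Qed.

Lemma complement_complete : language complement_automaton w.
Proof.
have [T TP] := choice component_complete.
(* The successor makes [T0] positive, so that the run begins in the subset phase. *)
pose T0 := (\max_j T j).+1.
have le_T j : T j <= T0 by apply/leqW/leq_bigmax.
have [c cP] := choice (fun j => TP j T0 (le_T j)).
pose x i := (reached w (T0 + i), [ffun j => c j i]).
have xv i : `[< forall j, valid (x i).1 ((x i).2 j) >].
  by apply/asboolP => j; rewrite /x /= ffunE; have [cv _ _] := cP j; exact: cv.
pose y i : {x : {set Q} * {ffun 'I_k -> component} |
              `[< forall j, valid x.1 (x.2 j) >]} := exist _ (x i) (xv i).
pose R t : macro_state := if t < T0 then inl (reached w t) else inr (y (t - T0)).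
have RT i : R (T0 + i) = inr (y i) by rewrite /R ltnNge leq_addr addKn.
exists R; split; last first.
  apply/acc_sat_big_and => j _; apply/inf_coloursP => N.
  have [_ _ /(_ N)[i le_i C0]] := cP j.
  exists (T0 + i); first by lia.
  by rewrite /run_transition -addnS !RT /= inE !ffunE C0.
split=> [|t]; first by rewrite inE.
rewrite inE; apply/asboolP; rewrite /run_transition /=.
have [lt_t|le_t] := ltnP t T0; last first.
  rewrite -(subnKC le_t) -addnS !RT /= addnS; split=> // j.
  by rewrite !ffunE; have [_ steps _] := cP j; exact: steps.
rewrite {1}/R lt_t.
have [lt_t'|le_t'] := ltnP t.+1 T0; first by rewrite /R lt_t'.
have -> : t.+1 = T0 + 0 by lia.
rewrite RT; change (reached w (T0 + 0) = reached w t.+1).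
by congr reached; lia.
Qed.
End Complete.

(* The code of a valid component is a tight function on Q with one extra point:
   this point and the states outside P share the otherwise unused odd value
   (ix c).+1, and the obligations get the maximum. *)
Definition code J P c q : nat :=
  if q \notin P then (ix c).+1
  else if q \in ob c then J.*2.+3
  else if odd (rk c q) && (ix c < rk c q) then (rk c q).+2
  else rk c q.

Definition encode J P c : {ffun 'I_#|Q|.+1 -> nat} :=
  [ffun x => if unlift ord0 x is Some y then code J P c (enum_val y)
             else (ix c).+1].

Lemma encode0 J P c : encode J P c ord0 = (ix c).+1.
Proof. by rewrite ffunE unlift_none. Qed.

Lemma encode_lift J P c q : encode J P c (lift ord0 (enum_rank q)) = code J P c q.
Proof. by rewrite ffunE liftK enum_rankK. Qed.

Lemma code_bound J P c q : valid_at J P c ->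
  code J P c q <= (if ob c == finset.set0 then J.*2.+1 else J.*2.+3).
Proof.
move=> [[_ le_rk _ _] [ob_c _ ix_le ob0]]; rewrite /code.
case: ifPn => [_|/negPn qP]; first by case: ifP; lia.
have := le_rk q qP; case: eqP => [/[dup]/ob0[ixE _] ->|_].
  by rewrite inE /=; case: ifP; lia.
by case: ifP => _; [lia|case: ifP; lia].
Qed.

Lemma max_encode J P c : valid_at J P c ->
  \max_i encode J P c i = if ob c == finset.set0 then J.*2.+1 else J.*2.+3.
Proof.
move=> v; have [_ [ob_c _ ix_le ob0]] := v; apply/eqP.
rewrite eqn_leq; apply/andP; split.
  apply/bigmax_leqP => x _; rewrite ffunE; case: (unlift ord0 x) => [y|].
    exact: code_bound.
  by case: ifP; lia.
case: ifPn => [/eqP/ob0[ixE _]|/set0Pn[q qO]].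
  by rewrite -ixE -(encode0 J P c); exact: leq_bigmax.
have <- : encode J P c (lift ord0 (enum_rank q)) = J.*2.+3.
  by rewrite encode_lift /code qO; have [-> _] := ob_c q qO.
exact: leq_bigmax.
Qed.

(** Odd ranks below [ix c] are kept, the extra point supplies [(ix c).+1], odd ranks above are
    shifted past it, and obligations supply [J.*2.+3]. Without obligations [ix c] is [J.*2], so
    nothing is shifted and [(ix c).+1] is the maximum. *)
Lemma tight_encode J P c : valid_at J P c -> tight_fun (encode J P c).
Proof.
move=> v; rewrite /tight_fun max_encode //.
have [[_ _ rk_odd _] [ob_c ix_even ix_le ob0]] := v.
split=> [|s le_s s_odd]; first by case: ifP; rewrite /= odd_double.
have hit q : code J P c q = s -> exists i, encode J P c i = s.
  by move=> <-; exists (lift ord0 (enum_rank q)); rewrite encode_lift.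
have rk_code q s' : q \in P -> rk c q = s' -> odd s' ->
    code J P c q = if ix c < s' then s'.+2 else s'.
  move=> qP <- rk_q; rewrite /code qP rk_q /=.
  by case: ifP => // /ob_c[_ rkE]; rewrite -rkE rk_q in ix_even.
have [s_ix|] := eqVneq s (ix c).+1; first by exists ord0; rewrite encode0.
case: (ltngtP s (ix c).+1) => // [lt_s|gt_s] _.
  have lt_s' : s < J.*2 by lia.
  have [q qP rkq] := rk_odd s lt_s' s_odd.
  by apply: (hit q); rewrite (rk_code _ _ qP rkq s_odd); case: ifP; lia.
have [s_max|s_nmax] := eqVneq s J.*2.+3.
  move: le_s; case: ifPn => [|/set0Pn[q qO] _]; first by lia.
  by apply: (hit q); rewrite /code qO; have [-> _] := ob_c q qO.
have le_s' : s.-2 < J.*2.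
  by move: le_s; case: ifPn => [/eqP/ob0[ixE _]|_]; lia.
have s2_odd : odd s.-2 by lia.
have [q qP rkq] := rk_odd s.-2 le_s' s2_odd.
by apply: (hit q); rewrite (rk_code _ _ qP rkq s2_odd); case: ifP; lia.
Qed.

Lemma code_mem J P c q : valid_at J P c -> (q \in P) = (code J P c q != (ix c).+1).
Proof.
move=> [[_ le_rk _ _] [ob_c ix_even ix_le ob0]]; rewrite /code.
case: ifP => [/negbTE -> |/negbFE qP]; first by rewrite eqxx.
rewrite qP; symmetry; case: ifP => _; first by lia.
by case: ifP; lia.
Qed.

Lemma code_ob J P c q : valid_at J P c ->
  (q \in ob c) = (q \in P) && (code J P c q == \max_i encode J P c i).
Proof.
move=> v; rewrite max_encode //.
have [[_ le_rk _ _] [ob_c ix_even ix_le ob0]] := v; rewrite /code.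
case: (boolP (q \in P)) => [qP|nP] /=; last by apply: contraNF nP => /ob_c[].
case: ifPn => [qO|nO]; symmetry.
  by case: ifPn => [/eqP O0|]; [move: qO; rewrite O0 inE|rewrite eqxx].
have := le_rk q qP; have [/ob0[ixE rk_odd]|_] := eqVneq (ob c) finset.set0.
  by have := rk_odd q qP; case: ifP; lia.
by case: ifP; lia.
Qed.

Lemma code_rk J P c q : valid_at J P c -> rk c q =
  if q \notin P then 0 else if q \in ob c then ix c
  else if odd (code J P c q) && (ix c < code J P c q) then (code J P c q).-2
  else code J P c q.
Proof.
move=> [[_ _ _ rk0] [ob_c _ _ _]]; rewrite /code.
case: (boolP (q \in P)) => [qP|/rk0 //] /=.
case: (boolP (q \in ob c)) => [/ob_c[]//|_] /=.
case: (boolP (odd (rk c q) && (ix c < rk c q))) => H /=.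
  by case: ifP; lia.
by case: ifP; lia.
Qed.

(** The extra point reveals [ix c]; then [P] consists of the states with another value, the
    obligations are those of [P] at the maximum, and the shift can be undone. No knowledge of [J] is
    required. *)
Lemma encode_inj J J' P P' c c' : valid_at J P c -> valid_at J' P' c' ->
  encode J P c = encode J' P' c' -> c.1.1.2 = c'.1.1.2 -> P = P' /\ c = c'.
Proof.
move=> v v' e lbE; have ixE : ix c = ix c'.
  by have := encode0 J P c; rewrite e encode0 => -[].
have codeE q : code J P c q = code J' P' c' q by rewrite -!encode_lift e.
have PE : P = P'.
  by apply/finset.setP => q; rewrite (code_mem _ v) (code_mem _ v') codeE ixE.
have obE : ob c = ob c'.
  by apply/finset.setP => q; rewrite (code_ob _ v) (code_ob _ v') codeE e PE.
have rkE q : rk c q = rk c' q.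
  by rewrite (code_rk _ v) (code_rk _ v') codeE PE obE ixE.
split=> //; case: c c' lbE ixE obE rkE {v v' e codeE} => [[[f g] O] i].
move=> [[[f' g'] O'] i']; rewrite /ix /ob /rk /= => -> /val_inj -> -> rkE.
have -> // : f = f'.
by apply/ffunP => q; apply/val_inj/rkE.
Qed.

(** * Counting the macro states *)

Let tight_codes := fset_set [set f : {ffun 'I_#|Q|.+1 -> nat} | tight_fun f]%classic.

Lemma card_tight_codes : #|{: tight_codes}| = tight #|Q|.+1.
Proof. by rewrite -cardfE. Qed.

Lemma mem_tight_codes J P c : valid_at J P c -> encode J P c \in tight_codes.
Proof.
move=> /tight_encode tf; rewrite in_fset_set; last exact: finite_tight_fun.
by rewrite inE.
Qed.

(** A set [P] is coded by the component of constant rank 0 whose obligations are all of [P]. This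
    absorbs the subset phase into the bound. *)
Lemma card_subsets_tight (x0 : 'I_l) : 2 ^ #|Q| <= tight #|Q|.+1.
Proof.
pose c P : component := ([ffun=> ord0], [ffun=> x0], P, ord0).
have v P : valid_at 0 P (c P).
  split; first by split=> // q; rewrite /rk /= ffunE.
  split=> // [q|]; rewrite /ob /rk /=; first by rewrite ffunE.
  by move=> ->; split=> // q; rewrite inE.
pose h P : tight_codes := FSetSub (mem_tight_codes (v P)).
have h_inj : injective h.
  by move=> P P' /(congr1 val) /= /(encode_inj (v P) (v P')) /=; case.
have := leq_card h h_inj.
by rewrite card_tight_codes card_set_type.
Qed.

(** Each phase contributes at most the product. In the ranking phase a state is recovered from its
    codes and labels; as [k] is positive, some component reveals the reached set. *)
Lemma card_macro_state : 0 < k -> 0 < l ->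
  #|macro_state| <= 2 * (l ^ (#|Q| * k) * tight #|Q|.+1 ^ k).
Proof.
move=> k_gt0 l_gt0; pose j0 := Ordinal k_gt0.
rewrite card_sum mul2n -addnn leq_add //.
  rewrite card_set_type.
  apply: leq_trans (card_subsets_tight (Ordinal l_gt0)) _.
  apply: (@leq_trans (tight #|Q|.+1 ^ k)); last first.
    by rewrite leq_pmull // expn_gt0 l_gt0.
  have [t0|t_gt0] := posnP (tight #|Q|.+1); first by rewrite t0.
  by rewrite -[leqLHS]expn1 leq_pexp2l.
have -> : l ^ (#|Q| * k) * tight #|Q|.+1 ^ k =
    #|{ffun 'I_k -> tight_codes * {ffun Q -> 'I_l}}|.
  rewrite card_ffun card_prod card_tight_codes card_ffun !card_ord.
  by rewrite expnMn mulnC expnM.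
have ex (z : {x : {set Q} * {ffun 'I_k -> component} |
      `[< forall j, valid x.1 (x.2 j) >]} * 'I_k) :
    exists g : tight_codes, exists2 J, valid_at J (val z.1).1 ((val z.1).2 z.2) &
      val g = encode J (val z.1).1 ((val z.1).2 z.2).
  case: z => -[x /= /[dup] /asboolP xv ?] j /=; have [J v] := xv j.
  by exists (FSetSub (mem_tight_codes v)), J.
have [h hP] := choice ex.
apply: (@leq_card _ _ (fun z => [ffun j => (h (z, j), ((val z).2 j).1.1.2)])).
move=> z z' /ffunP e; apply/val_inj.
have {}e j : (val z).1 = (val z').1 /\ (val z).2 j = (val z').2 j.
  have := e j; rewrite !ffunE => -[eh elb].
  have [J v hE] := hP (z, j); have [J' v' hE'] := hP (z', j).
  by apply: (encode_inj v v') elb; rewrite -hE eh hE'.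
case: (val z) (val z') e => [P F] [P' F'] /= e.
have [-> _] := e j0; congr pair; apply/ffunP => j; by have [] := e j.
Qed.
End Complement.

Lemma complementation (Sigma Gamma : finType) (n k l : nat)
    (A : el_automaton Sigma Gamma) :
  0 < l -> #|el_state A| = n -> is_generalized_rabin k l A ->
  exists B : el_automaton Sigma 'I_k,
    [/\ is_generalized_buchi B,
        #|el_state B| <= 2 * (l ^ (n * k) * tight n.+1 ^ k)
      & language B = (~` language A)%classic].
Proof.
move=> l_gt0 <- [b [G [leG accA]]].
have [k0|k_gt0] := posnP k; last first.
  exists (@complement_automaton _ _ A k l b G); split=> //.
    exact: card_macro_state.
  apply/seteqP; split=> w; first exact: complement_sound accA w.
  by move=> nLw; apply: complement_complete accA (Ordinal l_gt0) _ nLw leG.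
(* The components do not record the set of reached states when k = 0. *)
exists (@ELAutomaton Sigma 'I_k unit [set: _] [set: _] (fun=> finset.set0)
  (\big[@AccAnd 'I_k/AccTrue]_(j < k) Inf j)); split=> //.
  by rewrite k0 muln0 !expn0 card_unit.
have no (j : 'I_k) : False by move: j; rewrite k0 => -[].
apply/seteqP; split=> w; last first.
  move=> _; exists (fun=> tt); split; first by split=> [|i]; rewrite inE.
  by apply/acc_sat_big_and => j; case: (no j).
by move=> _ [rho [_]]; rewrite accA acc_sat_big_or => -[j]; case: (no j).
Qed.

(** * Counting tight functions *)

Lemma card_inverse (X Y : finType) (A : {set X}) (B : {set Y})
    (f : X -> Y) (g : Y -> X) :
  (forall x, x \in A -> f x \in B /\ g (f x) = x) ->
  (forall y, y \in B -> g y \in A /\ f (g y) = y) -> #|A| = #|B|.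
Proof.
move=> fP gP; have f_inj : {in A &, injective f}.
  by move=> x x' /fP[_ e] /fP[_ e'] ff; rewrite -e ff e'.
rewrite -(card_in_imset f_inj); apply: eq_card => y.
apply/imsetP/idP => [[x /fP[fB _] ->] //|/gP[gA e]].
by exists (g y).
Qed.

Section RankedFunctions.
Variables (T : finType) (m : nat).
Implicit Types (D E U : {set T}) (J : nat) (f g : {ffun T -> 'I_m.+1}).

(** For positive [J] these are the tight functions on [D] with maximum [J.*2.-1]. Extending them by
    0 keeps one function type while the domain varies. *)
Definition ranked D J : {set {ffun T -> 'I_m.+1}} :=
  [set f : {ffun T -> 'I_m.+1} | [&& [forall (x | x \notin D), f x == 0 :> nat],
    [forall x in D, f x < J.*2] &
    [forall j : 'I_J, [exists x in D, f x == j.*2.+1 :> nat]]]].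

Lemma rankedP D J f : reflect
  [/\ forall x, x \notin D -> f x = 0 :> nat,
      forall x, x \in D -> f x < J.*2 &
      forall j, j < J -> exists2 x, x \in D & f x = j.*2.+1 :> nat]
  (f \in ranked D J).
Proof.
rewrite inE; apply: (iffP and3P) => -[f0 f_lt f_hit]; split.
- by move=> x xD; apply/eqP; exact: (forall_inP f0).
- exact/forall_inP.
- move=> j lt_j.
  by have /exists_inP[x xD /eqP] := forallP f_hit (Ordinal lt_j); exists x.
- by apply/forall_inP => x xD; apply/eqP/f0.
- exact/forall_inP.
- apply/forallP => j; have [x xD fx] := f_hit j (ltn_ord j).
  by apply/exists_inP; exists x => //; apply/eqP.
Qed.

Lemma card_ranked0 D : #|ranked D 0| = (#|D| == 0).
Proof.
have [D0|[x xD]] := set_0Vmem D.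
  rewrite D0 cards0; apply/eqP/cards1P; exists [ffun=> ord0].
  apply/finset.setP => f; rewrite inE; apply/rankedP/eqP => [[f0 _ _]|->].
    by apply/ffunP => x; rewrite ffunE; apply/val_inj/f0; rewrite inE.
  by split=> // x; rewrite ?inE // ffunE.
rewrite cards_eq0; have /finset.set0Pn/negbTE -> : exists x, x \in D by exists x.
apply/eqP; rewrite cards_eq0; apply/eqP/finset.setP => f; rewrite [RHS]inE.
by apply/negbTE/rankedP => -[_ /(_ x xD)].
Qed.

(* E is the set of arguments of value 0 or 1, and U that of value 1. *)
Lemma card_rankedS D J : J.*2.+1 <= m ->
  #|ranked D J.+1| = \sum_(E : {set T} | E \subset D)
    (2 ^ #|E| - 1) * #|ranked (D :\: E) J|.
Proof.
move=> le_m; pose Y :=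
  [set p : {set T} * {set T} * {ffun T -> 'I_m.+1} | [&& p.1.1 \subset D,
     p.1.2 \in powerset p.1.1 :\ finset.set0 &
     p.2 \in ranked (D :\: p.1.1) J]].
transitivity #|Y|; last first.
  rewrite -sum1_card (eq_bigl (fun p : {set T} * {set T} * {ffun T -> 'I_m.+1}
    => ((p.1.1 \subset D) &&
    (p.1.2 \in powerset p.1.1 :\ finset.set0)) &&
    (p.2 \in ranked (D :\: p.1.1) J))); last by move=> p; rewrite inE andbA.
  rewrite -(pair_big_dep (fun a : {set T} * {set T} => (a.1 \subset D) &&
    (a.2 \in powerset a.1 :\ finset.set0))
    (fun (a : {set T} * {set T}) g => g \in ranked (D :\: a.1) J) (fun _ _ => 1)) /=.
  rewrite -(pair_big_dep (fun E : {set T} => E \subset D)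
    (fun E U => U \in powerset E :\ finset.set0)
    (fun E U => \sum_(g in ranked (D :\: E) J) 1)) /=.
  apply: eq_bigr => E _; rewrite sum_nat_const sum1_card; congr (_ * _).
  have := cardsD1 finset.set0 (powerset E).
  by rewrite card_powerset inE finset.sub0set => ->; rewrite addKn.
(* Higher values drop by 2; truncated subtraction sends 0 and 1 to 0, as is required outside the new
   domain. *)
pose split_low f : {set T} * {set T} * {ffun T -> 'I_m.+1} :=
  ([set x in D | f x <= 1], [set x in D | f x == 1 :> nat],
   [ffun x => inord (f x - 2)]).
pose join_low (p : {set T} * {set T} * {ffun T -> 'I_m.+1}) :
    {ffun T -> 'I_m.+1} :=
  [ffun x => if x \in p.1.2 then inord 1
     else if x \in D :\: p.1.1 then inord (p.2 x + 2) else ord0].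
have lt1 : 1 < m.+1 by lia.
apply: (@card_inverse _ _ _ _ split_low join_low).
  refine (fun f : {ffun T -> 'I_m.+1} => _).
  move=> /rankedP[f0 f_lt f_hit].
  have gE x : (split_low f).2 x = f x - 2 :> nat.
    by rewrite ffunE inordK //; have := ltn_ord (f x); lia.
  split.
    rewrite inE; apply/and3P; split.
    - by apply/fintype.subsetP => x; rewrite !inE => /andP[].
    - rewrite in_setD1 powersetE; apply/andP; split.
        have [x xD fx] := f_hit 0 isT; apply/finset.set0Pn; exists x.
        by rewrite inE xD fx.
      by apply/fintype.subsetP => x; rewrite !inE => /andP[-> /eqP ->].
    apply/rankedP; split=> [x|x|j lt_j].
    - rewrite !inE gE; have [xD|/f0 ->//] := boolP (x \in D); lia.
    - rewrite !inE gE => /andP[nE xD]; rewrite xD in nE.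
      by have := f_lt x xD; lia.
    have [x xD fx] := f_hit j.+1 lt_j; exists x; last by rewrite gE fx; lia.
    by rewrite !inE xD fx.
  apply/ffunP => x; apply/val_inj; rewrite ffunE /= !inE.
  have [xD|/f0 f0x] := boolP (x \in D); last by rewrite /= f0x.
  rewrite /= andbT; case: eqP => [->|ne1]; first by rewrite inordK.
  have gx := gE x; rewrite /= in gx; rewrite gx -ltnNge.
  case: ltnP => [lt|]; last by rewrite /=; lia.
  by rewrite inordK subnK.
case=> -[E U]; refine (fun g : {ffun T -> 'I_m.+1} => _).
rewrite inE in_setD1 powersetE /=.
move=> /and3P[sED /andP[U0 sUE] /rankedP[g0 g_lt g_hit]].
have UE x : x \in U -> x \in E by move/fintype.subsetP: sUE; apply.
have ED x : x \in E -> x \in D by move/fintype.subsetP: sED; apply.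
have fE x : join_low (E, U, g) x = (if x \in U then 1 else
    if x \in D :\: E then g x + 2 else 0) :> nat.
  rewrite ffunE /=; case: ifP => _; first by rewrite inordK.
  by case: ifP => // /g_lt lt; rewrite inordK //; lia.
have fE1 x : (join_low (E, U, g) x == 1 :> nat) = (x \in U).
  by rewrite fE; case: ifP => // _; case: ifP => // _; lia.
have fEle x : x \in D -> (join_low (E, U, g) x <= 1) = (x \in E).
  rewrite fE !inE => ->; case: ifP => [/UE -> //|_].
  by rewrite andbT; case: (x \in E) => //=; lia.
split.
  apply/rankedP; split=> [x xD|x xD|[|j] lt_j].
  - rewrite fE !inE (negbTE xD) andbF; case: ifP => // /UE/ED.
    by rewrite (negbTE xD).
  - by rewrite fE; case: ifP => // _; case: ifP => // /g_lt; lia.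
  - have /finset.set0Pn[x xU] := U0; exists x; first exact/ED/UE.
    by rewrite fE xU.
  have [x xDE gx] := g_hit j lt_j; exists x; first by case/setDP: xDE.
  rewrite fE xDE gx; case: ifP => [/UE xE|_]; last by lia.
  by case/setDP: xDE; rewrite xE.
congr (_, _, _).
- apply/finset.setP => x; rewrite inE.
  have [xD|nD] := boolP (x \in D); first exact: fEle.
  by apply/esym/negbTE; apply: contra nD => /ED.
- apply/finset.setP => x; rewrite inE fE1.
  by case: (boolP (x \in U)) => [/UE/ED ->|]; rewrite ?andbF.
- apply/ffunP => x; apply/val_inj; rewrite ffunE /= fE.
  case: ifP => [/UE xE|_].
    by rewrite inordK // g0 // !inE xE.
  case: ifPn => [_|/g0 ->]; last by rewrite inordK.
  by rewrite addnK inord_val.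
Qed.
End RankedFunctions.

Fixpoint ranked_count J n : nat :=
  if J is J'.+1 then
    \sum_(e < n.+1) 'C(n, e) * (2 ^ e - 1) * ranked_count J' (n - e)
  else (n == 0).

Lemma sum_subsets_card (T : finType) (D : {set T}) (F : nat -> nat) :
  \sum_(E : {set T} | E \subset D) F #|E| = \sum_(e < #|D|.+1) 'C(#|D|, e) * F e.
Proof.
rewrite (partition_big (fun E : {set T} => inord #|E| : 'I_#|D|.+1) xpredT) //=.
apply: eq_bigr => e _; rewrite -cards_draws -[X in _ = X * _]sum1_card big_distrl /=.
have cE (E : {set T}) : E \subset D -> (inord #|E| : 'I_#|D|.+1) = #|E| :> nat.
  by move=> sED; rewrite inordK // ltnS subset_leq_card.
have eqe (E : {set T}) : E \subset D -> ((inord #|E| : 'I_#|D|.+1) == e) = (#|E| == e).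
  by move=> sED; rewrite -val_eqE /= cE.
rewrite (eq_bigl (fun E => E \in [set E : {set T} | E \subset D & #|E| == e])).
  by apply: eq_bigr => E; rewrite inE => /andP[_ /eqP ->]; rewrite mul1n.
by move=> E; rewrite inE; case: (boolP (E \subset D)) => //= /eqe.
Qed.

Lemma card_ranked (T : finType) m (D : {set T}) J : J.*2 <= m.+1 ->
  #|ranked m D J| = ranked_count J #|D|.
Proof.
elim: J D => [|J IH] D le_J; first by rewrite card_ranked0.
rewrite card_rankedS; last by lia.
rewrite -[RHS]/(\sum_(e < #|D|.+1) _).
under [RHS]eq_bigr => e _ do rewrite -mulnA.
rewrite -(sum_subsets_card D (fun e => (2 ^ e - 1) * ranked_count J (#|D| - e))).
apply: eq_bigr => E sED; rewrite IH; last by lia.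
by rewrite cardsD (finset.setIidPr sED).
Qed.

(** Each level uses up at least one argument, since the weight for [e = 0] vanishes. *)
Lemma ranked_count_eq0 J n : n < J -> ranked_count J n = 0.
Proof.
elim: J n => // J IH n lt_n /=; apply: big1 => e _.
case: (posnP e) => [->|e_gt0]; first by rewrite expn0 subnn muln0 mul0n.
by rewrite IH ?muln0 //; have := ltn_ord e; lia.
Qed.

(** Tight functions are sorted by their maximum [J.*2.+1]; [tight_fun_bound] allows a finite
    codomain. *)
Lemma tight_ranked_count n : tight n = \sum_(J < n.+1) ranked_count J.+1 n.
Proof.
pose m := n.*2.+1.
pose X := [set f : {ffun 'I_n -> 'I_m.+1} |
  `[< tight_fun ([ffun i => val (f i)] : {ffun 'I_n -> nat}) >]].
pose h (f : {ffun 'I_n -> 'I_m.+1}) : {ffun 'I_n -> nat} := [ffun i => val (f i)].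
have h_inj : injective h.
  by move=> f g /ffunP e; apply/ffunP => i; apply/val_inj; have := e i; rewrite !ffunE.
transitivity #|X|.
  rewrite /tight (_ : fset_set _ = [fset h f | f in X]%fset).
    by rewrite card_in_imfset /= ?cardE //; move=> f g _ _ /h_inj.
  apply/fsetP => f; rewrite in_fset_set; last exact: finite_tight_fun.
  apply/idP/imfsetP => [|[g /= gX ->]]; last first.
    by rewrite inE /=; move: gX; rewrite inE => /asboolP.
  rewrite inE /= => tf; have lt_f := tight_fun_bound tf.
  have fE : f = h [ffun i => inord (f i)].
    by apply/ffunP => i; rewrite !ffunE /= inordK //; have := lt_f i; lia.
  exists [ffun i => inord (f i)] => //=; rewrite inE; apply/asboolP.
  by rewrite -/(h _) -fE.
rewrite -sum1_card (partition_big (fun f : {ffun 'I_n -> 'I_m.+1} =>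
  inord (\max_i f i)./2 : 'I_n.+1) xpredT) //.
apply: eq_bigr => J _.
have -> : ranked_count J.+1 n = #|ranked m [set: 'I_n] J.+1|.
  by rewrite card_ranked ?cardsT ?card_ord //; have := ltn_ord J; lia.
rewrite -sum1_card; apply: eq_bigl => f; rewrite inE.
have maxE : \max_i h f i = \max_i f i by apply: eq_bigr => i _; rewrite ffunE.
apply/andP/rankedP => [[/asboolP tf /eqP JE]|[_ f_lt f_hit]].
  have lt_f i : f i < n.*2 by have := tight_fun_bound tf i; rewrite ffunE.
  have [max_odd hit] := tf; rewrite maxE in max_odd hit.
  have lt_max : \max_i f i <= n.*2 by apply/bigmax_leqP => i _; exact: ltnW.
  have {}JE : J = (\max_i f i)./2 :> nat by rewrite -JE inordK //; lia.
  have maxJ : \max_i f i = J.*2.+1 by rewrite JE -[LHS]odd_double_half max_odd.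
  split=> [i|i _|j lt_j]; first by rewrite inE.
    have le_fi : f i <= \max_i f i by exact: (leq_bigmax i).
    by apply: leq_ltn_trans le_fi _; rewrite maxJ doubleS.
  have [||i] := hit j.*2.+1; [by rewrite maxJ ltnS leq_double|by rewrite /= odd_double|].
  by rewrite ffunE => fi; exists i; rewrite ?inE.
have max_le : \max_i f i <= J.*2.+1.
  by apply/bigmax_leqP => i _; have := f_lt i (finset.in_setT i); rewrite doubleS ltnS.
have maxJ : \max_i f i = J.*2.+1.
  apply/eqP; rewrite eqn_leq max_le /=; have [i _ <-] := f_hit J (ltnSn J).
  exact: leq_bigmax.
split; last by rewrite maxJ -val_eqE /= uphalf_double inordK.
apply/asboolP; rewrite /tight_fun -/(h f) maxE maxJ /= odd_double.
split=> // s le_s s_odd.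
have [|i _ fi] := f_hit s./2.
  rewrite ltnS -leq_double -ltnS (leq_trans _ le_s) //.
  by rewrite -[leqRHS]odd_double_half s_odd.
by exists i; rewrite ffunE /= fi -[RHS]odd_double_half s_odd.
Qed.

(** The empty function is not tight, its maximum being 0; counting it gives the renewal equation its
    initial value 1. *)
Definition tight1 n := (n == 0) + tight n.

Lemma tight1_ranked_count n M : n < M -> tight1 n = \sum_(J < M) ranked_count J n.
Proof.
have tail d : \sum_(J < n.+1 + d) ranked_count J n = \sum_(J < n.+1) ranked_count J n.
  elim: d => [|d IH]; first by rewrite addn0.
  rewrite addnS -(big_mkord xpredT (fun J => ranked_count J n)) big_nat_recr //.
  by rewrite big_mkord IH ranked_count_eq0 /= ?addn0 // addSn ltnS leq_addr.
move=> lt_n; rewrite -(subnKC lt_n) tail -(tail 1) addn1 big_ord_recl /=.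
by rewrite /tight1 tight_ranked_count.
Qed.

Lemma tight1_rec n : 0 < n ->
  tight1 n = \sum_(e < n.+1) 'C(n, e) * (2 ^ e - 1) * tight1 (n - e).
Proof.
(* Once [J = 0] is split off, [n.+1] values remain, enough for every [tight1 (n - e)]. *)
move=> n_gt0; rewrite (@tight1_ranked_count _ n.+2) // big_ord_recl /=.
rewrite (gtn_eqF n_gt0) add0n exchange_big /=; apply: eq_bigr => e _.
rewrite (@tight1_ranked_count _ n.+1); last by rewrite ltnS leq_subr.
by rewrite big_distrr.
Qed.

Local Open Scope ring_scope.

(** * Asymptotics *)

Section ExponentialSums.
Variable R : realType.
Implicit Types (x y : R) (n M : nat).

Definition exp_sum x n : R := \sum_(k < n) x ^+ k / k`!%:R.

Lemma exp_sumS x n : exp_sum x n.+1 = exp_sum x n + x ^+ n / n`!%:R.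
Proof. by rewrite /exp_sum big_ord_recr. Qed.

Lemma cvg_exp_sum x : (exp_sum x @ \oo --> expR x)%classic.
Proof.
rewrite (_ : exp_sum x = series (exp_coeff x)); last by rewrite seriesEord.
exact: is_cvg_series_exp_coeff.
Qed.

Lemma exp_sum_ndecr x : 0 <= x -> {homo exp_sum x : m n / (m <= n)%N >-> m <= n}.
Proof.
move=> x_ge0; apply/nondecreasing_seqP => n.
by rewrite exp_sumS lerDl divr_ge0 ?exprn_ge0.
Qed.

Lemma exp_sum_le x n : 0 <= x -> exp_sum x n <= expR x.
Proof.
move=> x_ge0; have <- := cvg_lim (@Rhausdorff R) (@cvg_exp_sum x).
apply: nondecreasing_cvgn_le; first exact: exp_sum_ndecr.
by apply/cvg_ex; exists (expR x); exact: cvg_exp_sum.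
Qed.

(** The remainder is dominated by a geometric series of ratio [x]; accordingly the bounds [B]
    decrease in [n] while staying above the partial sums. *)
Lemma le_exp_sum x n : 0 <= x < 1 ->
  expR x <= exp_sum x n + x ^+ n / n`!%:R / (1 - x).
Proof.
move=> /andP[x_ge0 x_lt1]; set B := fun n => exp_sum x n + x ^+ n / n`!%:R / (1 - x).
have Bni : {homo B : m n / (m <= n)%N >-> n <= m}.
  apply/nonincreasing_seqP => {}n; rewrite /B exp_sumS -addrA lerD2l.
  have t_ge0 : 0 <= x ^+ n / n`!%:R by rewrite divr_ge0 ?exprn_ge0.
  have -> : x ^+ n.+1 / n.+1`!%:R = x ^+ n / n`!%:R * (x / n.+1%:R).
    by rewrite factS natrM exprSr invfM; ring.
  set t := x ^+ n / _ in t_ge0 *.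
  have le1 : x / n.+1%:R <= x by rewrite ler_pdivrMr ?ltr0n // ler_peMr // ler1n.
  rewrite -mulrA -[X in X + _]mulr1 -mulrDr ler_wpM2l //.
  rewrite -lerBrDl (_ : (1 - x)^-1 - 1 = x / (1 - x)); last by field; lra.
  by rewrite ler_wpM2r // invr_ge0; lra.
have le_B m : exp_sum x m <= B m by rewrite lerDl !divr_ge0 ?exprn_ge0 //; lra.
have <- := cvg_lim (@Rhausdorff R) (@cvg_exp_sum x).
apply: limr_le; first by apply/cvg_ex; exists (expR x); exact: cvg_exp_sum.
near=> m; apply: le_trans (le_B m) _; apply: Bni.
by near: m; exact: nbhs_infty_ge.
Unshelve. all: by end_near. Qed.

Lemma expr_fact_le_exp x n : 0 <= x -> x ^+ n / n`!%:R <= expR x.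
Proof.
move=> x_ge0; apply: le_trans (exp_sum_le n.+1 x_ge0); rewrite exp_sumS lerDr.
by apply: sumr_ge0 => i _; rewrite divr_ge0 ?exprn_ge0.
Qed.

Lemma fact_ge n : (n%:R / expR 1) ^+ n <= n`!%:R :> R.
Proof.
rewrite expr_div_n -expRM_natr mul1r ler_pdivrMr ?expR_gt0 // mulrC.
by rewrite -ler_pdivrMr ?ltr0n ?fact_gt0 // expr_fact_le_exp.
Qed.

(** By induction; the quotient of consecutive bounds is controlled by (1 - 1/m)^m <= 1/e, an
    instance of 1 + y <= exp y. *)
Lemma fact_le n : (0 < n)%N ->
  n`!%:R <= expR 1 * n%:R * (n%:R / expR 1) ^+ n :> R.
Proof.
case: n => // n _; have e0 : expR 1 != 0 :> R by rewrite gt_eqF ?expR_gt0.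
elim: n => [|n IH]; first by rewrite expr1 mulr1 mul1r mulfV.
have n0 : (n.+1%:R : R) != 0 by rewrite pnatr_eq0.
have n1 : (n.+2%:R : R) != 0 by rewrite pnatr_eq0.
rewrite factS natrM mulrC; apply: le_trans (ler_wpM2r _ IH) _; first exact: ler0n.
have step : (n.+1%:R / n.+2%:R) ^+ n.+2 <= (expR 1)^-1 :> R.
  have -> : (n.+1%:R / n.+2%:R) = 1 - n.+2%:R^-1 :> R.
    by apply: (mulIf n1); rewrite mulrBl !mulfVK // mul1r mulVf // -[n.+2%:R]natr1 addrK.
  have -> : (expR 1)^-1 = expR (- n.+2%:R^-1) ^+ n.+2 :> R.
    by rewrite -expRM_natr mulNr mulVf // expRN.
  apply: lerXn2r; last exact: expR_ge1Dx.
    by rewrite nnegrE subr_ge0 invf_le1 ?ler1n ?ltr0n.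
  by rewrite nnegrE expR_ge0.
have -> (u v E : R) m : v != 0 -> E != 0 -> E * u * (u / E) ^+ m.+1 * v =
    E * v * (v / E) ^+ m.+2 * (E * (u / v) ^+ m.+2).
  move=> v0 E0; rewrite !expr_div_n !exprS; field.
  by rewrite !expf_neq0 // v0 E0.
- apply: ler_piMr.
    apply: mulr_ge0; first by apply: mulr_ge0 => //; exact: expR_ge0.
    by apply/exprn_ge0/divr_ge0 => //; exact: expR_ge0.
  by rewrite mulrC -ler_pdivlMr ?expR_gt0 // mul1r.
- exact: n1.
- exact: e0.
Qed.

Lemma linear_le_expr r C : 1 < r -> 0 <= C ->
  exists N, forall n, (N <= n)%N -> C * n.+1%:R <= r ^+ n :> R.
Proof.
move=> r_gt1 C_ge0; have L_gt0 : 0 < ln r by rewrite ln_gt0.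
have L2_gt0 : 0 < ln r ^+ 2 by rewrite exprn_gt0.
(* Beyond this constant, C(n + 1) <= 2Cn <= (n ln r)^2 / 2, which is the quadratic term of the
   exponential series. *)
have K_ge0 : 0 <= 4 * C / ln r ^+ 2 by rewrite divr_ge0 ?mulr_ge0 // ltW.
exists (Num.Def.archi_bound (4 * C / ln r ^+ 2)).+1 => n le_n.
have n_gt0 : (0 < n)%N by case: n le_n.
have leK : 4 * C <= n%:R * ln r ^+ 2.
  rewrite -ler_pdivrMr //; apply/ltW/(lt_le_trans (archi_boundP K_ge0)).
  by rewrite ler_nat ltnW.
have rE : r = expR (ln r) by rewrite lnK // posrE (lt_trans ltr01).
rewrite rE -expRM_natr.
apply: le_trans (expR_ge1Dxn 1 _); last by rewrite mulr_ge0 // ltW.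
rewrite exprMn -[2`!%N]/2%N.
have n1 : 1 <= n%:R :> R by rewrite ler1n.
have : n%:R * (4 * C) <= n%:R * (n%:R * ln r ^+ 2) by rewrite ler_wpM2l.
by rewrite -natr1; nra.
Qed.
End ExponentialSums.

(** * Growth rate of [tight] *)

Section TightAsymptotics.
Variable R : realType.
Implicit Types (x : R) (n M : nat).

(** The coefficients of exponential generating functions: exp(2y) - exp(y) for [block], and that of
    [tight1] for [egf]. In these terms the renewal equation is a plain convolution. *)
Definition block (e : nat) : R := (2 ^ e - 1)%N%:R / e`!%:R.
Definition egf n : R := (tight1 n)%:R / n`!%:R.

Lemma fact_neq0 n : (n`!%:R : R) != 0.
Proof. by rewrite pnatr_eq0 -lt0n fact_gt0. Qed.

Lemma block_ge0 e : 0 <= block e.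
Proof. by rewrite divr_ge0. Qed.

Lemma sum_block x M :
  \sum_(e < M) block e * x ^+ e = exp_sum (2 * x) M - exp_sum x M.
Proof.
rewrite /exp_sum -sumrB; apply: eq_bigr => e _.
by rewrite /block natrB ?expn_gt0 // natrX exprMn; ring.
Qed.

Lemma egf_rec x n : (0 < n)%N -> egf n * x ^+ n =
  \sum_(e < n.+1) (block e * x ^+ e) * (egf (n - e) * x ^+ (n - e)).
Proof.
move=> n_gt0; rewrite /egf tight1_rec // natr_sum !mulr_suml.
apply: eq_bigr => e _; have le_e : (e <= n)%N by rewrite -ltnS ltn_ord.
rewrite -[in x ^+ n](subnKC le_e) exprD !natrM -(bin_fact le_e) !natrM /block.
have C0 : ('C(n, e)%:R : R) != 0 by rewrite pnatr_eq0 -lt0n bin_gt0.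
by field; rewrite C0 !fact_neq0.
Qed.

Lemma block0 : block 0 = 0.
Proof. by rewrite /block subnn mul0r. Qed.

Lemma tight1_0 : tight1 0 = 1%N.
Proof. by rewrite (@tight1_ranked_count _ 1) // big_ord1. Qed.

Lemma tight1_gt0 n : (0 < tight1 n)%N.
Proof.
case: n => [|n]; first by rewrite tight1_0.
rewrite tight1_rec // big_ord_recr /= subnn binn tight1_0 mul1n muln1.
by rewrite addn_gt0 orbC subn_gt0 -[1%N](expn0 2) ltn_exp2l.
Qed.

Let phi : R := (1 + Num.sqrt 5) / 2.
Let lam : R := ln phi.

Lemma sqrt5_bounds : 2236 / 1000 <= (Num.sqrt 5 : R) <= 2237 / 1000.
Proof.
apply/andP; split.
  rewrite -[leLHS]ger0_norm; last by lra.
  by rewrite -sqrtr_sqr ler_sqrt; lra.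
rewrite -[leRHS]ger0_norm; last by lra.
by rewrite -sqrtr_sqr ler_sqrt; lra.
Qed.

Lemma expR_lam : expR lam = phi.
Proof. by rewrite lnK // posrE; have := sqrt5_bounds; rewrite /phi; lra. Qed.

Lemma phi_sq : phi ^+ 2 = phi + 1.
Proof.
have s5 : Num.sqrt 5 ^+ 2 = 5 :> R by rewrite sqr_sqrtr.
by rewrite /phi; field: s5.
Qed.

Let factE := (erefl : 0`! = 1, erefl : 1`! = 1, erefl : 2`! = 2,
  erefl : 3`! = 6, erefl : 4`! = 24, erefl : 5`! = 120, erefl : 6`! = 720)%N.

Lemma lam_bounds : 481 / 1000 <= lam <= 486 / 1000.
Proof.
have := sqrt5_bounds => sb; apply/andP; split; rewrite -ler_expR expR_lam.
  have x1 : 0 <= (481 / 1000 : R) < 1 by lra.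
  apply: le_trans (le_exp_sum 5 x1) _.
  rewrite (_ : (1 - 481 / 1000)^-1 = 1000 / 519 :> R); last by field.
  by rewrite /exp_sum !big_ord_recr big_ord0 /= !factE /phi; lra.
have x0 : 0 <= (486 / 1000 : R) by lra.
apply: le_trans (exp_sum_le 4 x0).
by rewrite /exp_sum !big_ord_recr big_ord0 /= !factE /phi; lra.
Qed.

Lemma expR1_bounds : 2718 / 1000 <= (expR 1 : R) <= 272 / 100.
Proof.
apply/andP; split.
  apply: le_trans (exp_sum_le 7 ler01).
  by rewrite /exp_sum !big_ord_recr big_ord0 /= !factE; lra.
(* The remainder estimate needs an argument below 1, so the square root of e is estimated first. *)
have -> : 1 = 2^-1 * 2%:R :> R by lra.
rewrite expRM_natr.
have x1 : 0 <= (2^-1 : R) < 1 by lra.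
have h := le_exp_sum 6 x1.
have h2 : expR 2^-1 <= 16488 / 10000 :> R.
  apply: le_trans h _; rewrite (_ : (1 - 2^-1)^-1 = 2 :> R); last by field.
  by rewrite /exp_sum !big_ord_recr big_ord0 /= !factE; lra.
by have := expR_ge0 (2^-1 : R); nra.
Qed.

Definition kappa : R := (expR 1 * lam)^-1.

(** The interval consists of the reals that round to 0.76. *)
Lemma kappa_bounds : 755 / 1000 <= kappa < 765 / 1000.
Proof.
have /andP[e1 e2] := expR1_bounds; have /andP[l1 l2] := lam_bounds.
have p1 : expR 1 * lam <= 272 / 100 * (486 / 1000).
  by apply: ler_pM e2 l2; lra.
have p2 : 2718 / 1000 * (481 / 1000) <= expR 1 * lam.
  by apply: ler_pM e1 l1; lra.
rewrite /kappa; move: (expR 1 * lam) p1 p2 => p p1 p2.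
have p_gt0 : 0 < p by lra.
rewrite -[p^-1]mul1r (ler_pdivlMr _ _ p_gt0) (ltr_pdivrMr _ _ p_gt0).
by apply/andP; split; lra.
Qed.

Lemma sum_block_lam M : \sum_(e < M) block e * lam ^+ e <= 1.
Proof.
have lam_ge0 : 0 <= lam by have := lam_bounds; lra.
have cv : ((fun M => \sum_(e < M) block e * lam ^+ e) @ \oo --> (1 : R))%classic.
  have -> : 1 = expR (2 * lam) - expR lam :> R.
    by rewrite (mulrDl 1 1) !mul1r expRD expR_lam -expr2 phi_sq; ring.
  rewrite (_ : (fun _ => _) = (fun M => exp_sum (2 * lam) M - exp_sum lam M)).
    by apply: cvgB; exact: cvg_exp_sum.
  by apply/funext => m; rewrite sum_block.
rewrite -(cvg_lim (@Rhausdorff R) cv); apply: nondecreasing_cvgn_le.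
  apply/nondecreasing_seqP => m; rewrite big_ord_recr lerDl.
  by rewrite mulr_ge0 ?block_ge0 // exprn_ge0.
by apply/cvg_ex; exists 1.
Qed.

Lemma sum_block_gt_lam x : lam < x ->
  exists M, forall m, (M <= m)%N -> 1 <= \sum_(e < m) block e * x ^+ e.
Proof.
move=> lt_x; have u_gt : phi < expR x by rewrite -expR_lam ltr_expR.
have cv : ((fun M => \sum_(e < M) block e * x ^+ e) @ \oo -->
    expR (2 * x) - expR x)%classic.
  rewrite (_ : (fun _ => _) = (fun M => exp_sum (2 * x) M - exp_sum x M)).
    by apply: cvgB; exact: cvg_exp_sum.
  by apply/funext => m; rewrite sum_block.
have gt1 : 1 < expR (2 * x) - expR x.
  rewrite (mulrDl 1 1) !mul1r expRD; have := phi_sq.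
  have : 1 < phi by have := sqrt5_bounds; rewrite /phi; lra.
  by nra.
have [M _ MP] := cvgr_ge _ cv _ gt1.
by exists M => m le_m; exact: MP.
Qed.

(* Since sum_block_lam bounds the total weight of a renewal equation by 1, its
   solution stays below its initial value. *)
Lemma egf_le n : egf n * lam ^+ n <= 1.
Proof.
have lam_ge0 : 0 <= lam by have := lam_bounds; lra.
have [m] := ubnP n; elim: m n => // m IH [_|n lt_n].
  by rewrite /egf tight1_0 !mulr1 divr1.
rewrite egf_rec //; apply: le_trans (sum_block_lam n.+2).
apply: ler_sum => e _; have [->|e_gt0] := posnP e; first by rewrite block0 !mul0r.
rewrite ler_piMr ?mulr_ge0 ?block_ge0 ?exprn_ge0 // IH //.
by have := ltn_ord e; lia.
Qed.

(** At [x] the weights add up to more than 1, so a lower bound on sufficiently many initial values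
    propagates through the renewal equation. *)
Lemma egf_ge x : lam < x -> exists2 c, 0 < c & forall n, c <= egf n * x ^+ n.
Proof.
move=> lt_x; have x_gt0 : 0 < x by have := lam_bounds; lra.
have [M MP] := sum_block_gt_lam lt_x.
have [c c_gt0 cP] : exists2 c, 0 < c & forall n, (n < M)%N -> c <= egf n * x ^+ n.
  elim: (M) => [|m [c c_gt0 cP]]; first by exists 1.
  exists (Num.min c (egf m * x ^+ m)).
    rewrite lt_min c_gt0 mulr_gt0 ?exprn_gt0 //.
    by rewrite divr_gt0 ?ltr0n ?tight1_gt0 ?fact_gt0.
  move=> n; rewrite ltnS leq_eqVlt ge_min => /predU1P[->|/cP ->//].
  by rewrite lexx orbT.
exists c => // n; have [m] := ubnP n; elim: m n => // m IH n lt_n.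
have [/cP //|le_M] := ltnP n M; have [n0|n_gt0] := posnP n.
  (* [M] is positive because an empty sum is below 1, so [n = 0] belongs to the initial values. *)
  rewrite n0 in le_M; have /MP : (M <= 0)%N by [].
  by rewrite big_ord0; lra.
rewrite egf_rec //; apply: le_trans (_ : c * \sum_(e < n.+1) block e * x ^+ e <= _).
  by rewrite ler_peMr ?MP ?ltW // leqW.
rewrite mulr_sumr; apply: ler_sum => e _.
have [->|e_gt0] := posnP e; first by rewrite block0 !mul0r mulr0.
rewrite mulrC ler_wpM2l ?mulr_ge0 ?block_ge0 ?exprn_ge0 ?(ltW x_gt0) //.
by apply: IH; lia.
Qed.

Lemma tight_le_fact n : (tight n)%:R <= n`!%:R / lam ^+ n.
Proof.
have lam_gt0 : 0 < lam by have := lam_bounds; lra.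
have := egf_le n; rewrite ler_pdivlMr ?exprn_gt0 // /egf mulrAC.
rewrite ler_pdivrMr ?ltr0n ?fact_gt0 // mul1r; apply: le_trans.
by rewrite ler_wpM2r ?exprn_ge0 ?(ltW lam_gt0) // ler_nat leq_addl.
Qed.

Lemma fact_le_kappa n : (0 < n)%N ->
  n`!%:R / lam ^+ n <= expR 1 * n%:R * (kappa * n%:R) ^+ n.
Proof.
have lam_gt0 : 0 < lam by have := lam_bounds; lra.
move=> n_gt0; rewrite ler_pdivrMr ?exprn_gt0 //.
apply: le_trans (fact_le R n_gt0) _; rewrite -[leRHS]mulrA -exprMn.
rewrite [kappa * _ * _](_ : _ = n%:R / expR 1) //.
by rewrite /kappa; field; rewrite !gt_eqF ?expR_gt0.
Qed.

Lemma tight_le n : (0 < n)%N ->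
  (tight n)%:R <= expR 1 * n%:R * (kappa * n%:R) ^+ n.
Proof.
move=> n_gt0; exact: le_trans (tight_le_fact n) (fact_le_kappa n_gt0).
Qed.

Lemma tight_ge r : 0 < r < 1 -> exists2 c, 0 < c &
  forall n, (0 < n)%N -> c * (r * (kappa * n%:R)) ^+ n <= (tight n)%:R.
Proof.
move=> /andP[r_gt0 r_lt1]; have lam_gt0 : 0 < lam by have := lam_bounds; lra.
have [|c c_gt0 cP] := @egf_ge (lam / r).
  by rewrite ltr_pdivlMr // gtr_pMr.
exists c => // n n_gt0; have := cP n; rewrite /egf /tight1 (gtn_eqF n_gt0) add0n.
have xn_gt0 : 0 < (lam / r) ^+ n by rewrite exprn_gt0 // divr_gt0.
rewrite mulrAC ler_pdivlMr ?ltr0n ?fact_gt0 // -ler_pdivrMr //; apply: le_trans.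
rewrite -mulrA ler_wpM2l ?(ltW c_gt0) // ler_pdivlMr // -exprMn.
apply: le_trans (fact_ge R n); rewrite le_eqVlt; apply/orP; left; apply/eqP.
by congr (_ ^+ n); rewrite /kappa; field; rewrite !gt_eqF ?expR_gt0.
Qed.

(** The polynomial factor of the upper bound and the constant of the lower bound vanish under the
    n-th root, since exponentials outgrow linear functions. *)
Lemma tight_exp_approx :
  exp_approx (fun n => (tight n)%:R : R) (fun n => (kappa * n%:R) ^+ n).
Proof.
have kappa_gt0 : 0 < kappa by have := kappa_bounds; lra.
apply/cvgrPdist_le => e e_gt0.
have e_lt : 1 < 1 + e by lra.
have [N1 N1P] := linear_le_expr e_lt (expR_ge0 1).
have root n (a : R) : (0 < n)%N -> 0 <= a -> (a ^+ n) `^ (n%:R^-1) = a.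
  move=> n_gt0 a_ge0; rewrite -(powR_mulrn n a_ge0) -powRrM mulfV ?powRr1 //.
  by rewrite pnatr_eq0 -lt0n.
have [N2 N2P] : exists N, forall n, (N <= n)%N -> (0 < n)%N ->
    1 - e <= ((tight n)%:R / (kappa * n%:R) ^+ n) `^ n%:R^-1.
  have [e_ge1|e_lt1] := leP 1 e.
    by exists 0%N => n _ _; apply: le_trans (powR_ge0 _ _); lra.
  (* This base lies strictly between 1 - e and 1; its excess over 1 - e absorbs the constant [c]. *)
  have r01 : 0 < 1 - e / 2 < 1 by lra.
  have [c c_gt0 cP] := tight_ge r01.
  have r_gt1 : 1 < (1 - e / 2) / (1 - e) by rewrite ltr_pdivlMr; lra.
  have ci_ge0 : 0 <= c^-1 by rewrite invr_ge0 ltW.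
  have [N NP] := linear_le_expr r_gt1 ci_ge0.
  exists N => n le_n n_gt0; rewrite -[leLHS](root n _) //; last by lra.
  have k_gt0 : 0 < (kappa * n%:R) ^+ n by rewrite exprn_gt0 // mulr_gt0 ?ltr0n.
  apply: ge0_ler_powR; rewrite ?invr_ge0 ?nnegrE ?ler0n //.
  - by rewrite exprn_ge0 //; lra.
  - by rewrite divr_ge0 // ltW.
  rewrite ler_pdivlMr //; apply: le_trans (cP n n_gt0).
  rewrite [in leRHS]exprMn mulrA ler_wpM2r ?(ltW k_gt0) //.
  have e1_gt0 : 0 < (1 - e) ^+ n by rewrite exprn_gt0 // subr_gt0.
  rewrite -ler_pdivrMl // mulrC -ler_pdivlMl //.
  have := NP n le_n; rewrite expr_div_n [in leRHS]mulrC; apply: le_trans.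
  by rewrite ler_peMr // ler1n.
near=> n.
have n_gt0 : (0 < n)%N by near: n; exact: nbhs_infty_gt.
have le1 : (N1 <= n)%N by near: n; exact: nbhs_infty_ge.
have le2 : (N2 <= n)%N by near: n; exact: nbhs_infty_ge.
have k_gt0 : 0 < (kappa * n%:R) ^+ n by rewrite exprn_gt0 // mulr_gt0 ?ltr0n.
have lo := N2P n le2 n_gt0.
have up : ((tight n)%:R / (kappa * n%:R) ^+ n) `^ n%:R^-1 <= 1 + e.
  rewrite -[leRHS](root n _) //; last by lra.
  apply: ge0_ler_powR; rewrite ?invr_ge0 ?nnegrE ?ler0n //.
  - by rewrite divr_ge0 // ltW.
  - by rewrite exprn_ge0 //; lra.
  apply: le_trans (N1P n le1); rewrite ler_pdivrMr //.
  apply: le_trans (tight_le n_gt0) _.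
  by rewrite ler_wpM2r ?(ltW k_gt0) // ler_wpM2l ?expR_ge0 // ler_nat.
by rewrite ler_distlC; apply/andP; split; lra.
Unshelve. all: by end_near. Qed.

(** Passing from [n] to [n.+1] costs a factor (n + 1) / lam. Together with e it is absorbed by the
    powers of c / kappa, and only the factor [n] survives. *)
Lemma tightS_le c : kappa < c -> exists N, forall n, (N <= n)%N ->
  (tight n.+1)%:R <= n%:R * (c * n%:R) ^+ n.
Proof.
move=> lt_c; have kappa_gt0 : 0 < kappa by have := kappa_bounds; lra.
have lam_gt0 : 0 < lam by have := lam_bounds; lra.
have r_gt1 : 1 < c / kappa by rewrite ltr_pdivlMr // mul1r.
have C_ge0 : 0 <= expR 1 / lam by rewrite divr_ge0 ?expR_ge0 // ltW.
have [N NP] := linear_le_expr r_gt1 C_ge0; exists N.+1 => n le_n.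
have n_gt0 : (0 < n)%N by apply: leq_ltn_trans le_n.
apply: le_trans (tight_le_fact n.+1) _.
have -> : n.+1`!%:R / lam ^+ n.+1 = n.+1%:R / lam * (n`!%:R / lam ^+ n) :> R.
  by rewrite factS natrM exprS invfM; ring.
apply: le_trans (_ : n.+1%:R / lam * (expR 1 * n%:R * (kappa * n%:R) ^+ n) <= _).
  by rewrite ler_wpM2l ?divr_ge0 ?(ltW lam_gt0) // fact_le_kappa.
have := NP n (ltnW le_n); rewrite expr_div_n ler_pdivlMr ?exprn_gt0 // => h.
have : expR 1 / lam * n.+1%:R * kappa ^+ n * (n%:R * n%:R ^+ n) <=
    c ^+ n * (n%:R * n%:R ^+ n) by rewrite ler_wpM2r // mulr_ge0 ?exprn_ge0.
by congr (_ <= _); rewrite !exprMn; ring.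
Qed.
End TightAsymptotics.

Theorem theorem5 (R : realType) :
  exists nstates : nat -> nat -> nat -> nat,
    (forall (Sigma Gamma : finType) (n k l : nat)
        (A : el_automaton Sigma Gamma),
      (0 < l)%N -> #|el_state A| = n -> is_generalized_rabin k l A ->
      exists B : el_automaton Sigma 'I_k,
        [/\ is_generalized_buchi B,
            (#|el_state B| <= nstates n k l)%N
          & language B = (~` language A)%classic])
    /\ (exists C : R, forall n k l : nat, (0 < l)%N ->
          (nstates n k l)%:R <= C * (l ^ (n * k) * tight n.+1 ^ k)%:R)
    /\ (exists kappa : R,
          [/\ 755 / 1000 <= kappa < 765 / 1000,
              exp_approx (fun n => (tight n)%:R) (fun n => (kappa * n%:R) ^+ n)
            & forall c : R, kappa < c ->
                exists (C : R) (N : nat), forall n k l : nat,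
                  (N <= n)%N -> (0 < l)%N ->
                  (nstates n k l)%:R <=
                    C * ((n ^ k)%:R * (c * l%:R * n%:R) ^+ (n * k))]).
Proof.
(* The factor 2 accounts for the two phases of the automaton. *)
exists (fun n k l => 2 * (l ^ (n * k) * tight n.+1 ^ k))%N.
split; first exact: complementation.
split; first by exists 2 => n k l _; rewrite natrM.
exists (kappa R); split; [exact: kappa_bounds | exact: tight_exp_approx |].
move=> c lt_c; have [N NP] := tightS_le lt_c; exists 2, N => n k l le_n l_gt0.
rewrite natrM ler_wpM2l // natrM !natrX.
have -> : c * l%:R * n%:R = l%:R * (c * n%:R) by rewrite mulrCA mulrA.
rewrite exprMn [(c * _) ^+ _]exprM [leRHS]mulrCA -exprMn ler_wpM2l ?exprn_ge0 //.
by apply: lerXn2r; rewrite ?nnegrE ?ler0n ?(le_trans _ (NP n le_n)) ?ler0n ?NP.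
Qed.
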